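(* Let $(X,\sigma_X)$, $(Y,\sigma_Y)$ be one-sided sofic shifts, $\pi:X\to Y$ a one-block factor map, $X$ with the specification property, and suppose Condition A holds. Let $\Phi_2=\{\log f_n\}$ be an almost additive potential on $Y$ with bounded variation and $\nu_{\Phi_2}\in M(Y,\sigma_Y)$ its unique invariant Gibbs measure. Then $\Phi_1=\{\log((f_n\circ\pi)/(\tilde\phi_n\circ\pi))\}_{n\ge1}$ is an almost additive potential on $X$ with bounded variation, its unique invariant Gibbs measure $\mu_{\Phi_1}$ satisfies $\pi\mu_{\Phi_1}=\nu_{\Phi_2}$, and $$\sup_{\mu\in M(X,\sigma_X)}\Big\{h_\mu(\sigma_X)+\lim_{n\to\infty}\tfrac1n\int\log\tfrac{f_n\circ\pi}{\tilde\phi_n\circ\pi}\,d\mu\Big\}=\sup_{m\in M(Y,\sigma_Y)}\Big\{h_m(\sigma_Y)+\lim_{n\to\infty}\tfrac1n\int\log f_n\,dm\Big\}.$$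
   Context: Sofic shifts: one-sided subshifts of $\{1,\dots,k\}^{\mathbb N}$ that are factors of shifts of finite type. Specification: $\exists p>0$ such that for all allowable $u,v$ there is $w$ of length $p$ with $uwv$ allowable. One-block factor map: continuous surjection commuting with shifts, $\pi(x)_i$ depending only on $x_i$. For $y\in Y$, $|\pi^{-1}[y_1\cdots y_n]|$ denotes the number of cylinders $[x_1\cdots x_n]$ in $X$ with $\pi([x_1\cdots x_n])\subseteq[y_1\cdots y_n]$, and $\tilde\phi_n(y)=|\pi^{-1}[y_1\cdots y_n]|$. Condition A: there is $0<D\le1$ such that for all $n,m$ and $y_1\cdots y_{n+m}\in B_{n+m}(Y)$, $D|\pi^{-1}[y_1\cdots y_n]|\,|\pi^{-1}[y_{n+1}\cdots y_{n+m}]|\le|\pi^{-1}[y_1\cdots y_{n+m}]|$. Almost additive: $\exists C>0$, $e^{-C}\phi_n(x)\phi_m(\sigma^nx)\le\phi_{n+m}(x)\le e^C\phi_n(x)\phi_m(\sigma^nx)$; bounded variation: $\sup_n\sup\{\phi_n(x)/\phi_n(x'):x_i=x'_i,1\le i\le n\}<\infty$. Gibbs measure: $\exists C_0$ with $C_0^{-1}<\mu([x_1\cdots x_n])/(e^{-nP(\Phi)}\phi_n(x))<C_0$ for all $x,n$, $P$ the topological pressure. *)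

(* Defs.v *)
From HB Require Import structures.
From mathcomp Require Import all_boot all_order all_algebra.
From mathcomp Require Import all_classical all_reals all_analysis.
Set Implicit Arguments. Unset Strict Implicit. Unset Printing Implicit Defensive.
Import Order.TTheory GRing.Theory Num.Theory numFieldNormedType.Exports.
Local Open Scope classical_set_scope.
Local Open Scope ring_scope.

(* One-sided full shift on the alphabet 'I_k.+1 (k+1 >= 1 symbols, standing
   for {1,...,k+1}); positions are indexed from 0 (x_0 x_1 ... for the
   paper's x_1 x_2 ...). *)
Definition sq (k : nat) := nat -> 'I_k.+1.
HB.instance Definition _ (k : nat) := gen_eqMixin (sq k).
HB.instance Definition _ (k : nat) := gen_choiceMixin (sq k).
HB.instance Definition _ (k : nat) := isPointed.Build (sq k) (fun _ => ord0).

Definition shift k (x : sq k) : sq k := fun i => x i.+1.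

Definition word k (x : sq k) (n : nat) : seq 'I_k.+1 := mkseq x n.

Definition cyl k (w : seq 'I_k.+1) : set (sq k) := [set x | word x (size w) = w].

Definition allowable k (X : set (sq k)) (w : seq 'I_k.+1) : Prop :=
  exists2 x, X x & cyl w x.

Definition cylinders k : set (set (sq k)) := [set cyl w | w in [set: seq 'I_k.+1]].
Definition sqm k := g_sigma_algebraType (@cylinders k).

Definition SFT k (F : seq (seq 'I_k.+1)) : set (sq k) :=
  [set x | forall i w, w \in F -> word (iter i (@shift k) x) (size w) <> w].

(* factor map Z -> X : continuous surjection commuting with the shifts
   (continuity w.r.t. the product topology, written out) *)
Definition factor_map k k' (Z : set (sq k')) (X : set (sq k))
  (phi : sq k' -> sq k) : Prop :=
  [/\ phi @` Z = X,
      (forall z, Z z -> phi (shift z) = shift (phi z)) &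
      (forall z N, Z z -> exists M, forall z', Z z' ->
          word z M = word z' M -> word (phi z) N = word (phi z') N)].

Definition sofic k (X : set (sq k)) : Prop :=
  exists (k' : nat) (F : seq (seq 'I_k'.+1)) (phi : sq k' -> sq k),
    factor_map (SFT F) X phi.

Definition specification k (X : set (sq k)) : Prop :=
  exists p : nat, (0 < p)%N /\
    forall u v : seq 'I_k.+1, (0 < size u)%N -> (0 < size v)%N ->
      allowable X u -> allowable X v ->
      exists w : seq 'I_k.+1, size w = p /\ allowable X (u ++ w ++ v).

Definition blockmap k l (p : 'I_k.+1 -> 'I_l.+1) (x : sq k) : sq l :=
  fun i => p (x i).

(* |pi^{-1}[y]| : number of cylinders [w] of X (w allowable in X) with
   pi([w]) contained in [y], i.e. p applied to w gives y *)
Definition npre k l (X : set (sq k)) (p : 'I_k.+1 -> 'I_l.+1)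
  (y : seq 'I_l.+1) : nat :=
  #|[set w : (size y).-tuple 'I_k.+1 |
       `[< allowable X (tval w) >] && (map p (tval w) == y)]|.

Definition tphi k l (X : set (sq k)) (p : 'I_k.+1 -> 'I_l.+1)
  (n : nat) (y : sq l) : nat := npre X p (word y n).

Definition conditionA (R : realType) k l (X : set (sq k)) (Y : set (sq l))
  (p : 'I_k.+1 -> 'I_l.+1) : Prop :=
  exists D : R, 0 < D <= 1 /\
    forall (n m : nat) (y : seq 'I_l.+1), size y = (n + m)%N -> allowable Y y ->
      D * (npre X p (take n y))%:R * (npre X p (drop n y))%:R
        <= (npre X p y)%:R.

Section Potentials.
Variable R : realType.

(* a potential {log f_n}_{n>=1} on S: each f_n is positive and continuous
   on S (f 0 is irrelevant) *)
Definition potential k (S : set (sq k)) (f : nat -> sq k -> R) : Prop :=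
  forall n, (0 < n)%N ->
    (forall x, S x -> 0 < f n x) /\
    (forall x (e : R), S x -> 0 < e -> exists N, forall x', S x' ->
        word x N = word x' N -> `|f n x - f n x'| < e).

Definition almost_additive k (S : set (sq k)) (f : nat -> sq k -> R) : Prop :=
  exists C : R, 0 < C /\ forall n m x, (0 < n)%N -> (0 < m)%N -> S x ->
    expR (- C) * f n x * f m (iter n (@shift k) x) <= f (n + m)%N x /\
    f (n + m)%N x <= expR C * f n x * f m (iter n (@shift k) x).

Definition bounded_var k (S : set (sq k)) (f : nat -> sq k -> R) : Prop :=
  exists B : R, forall n x x', (0 < n)%N -> S x -> S x' ->
    word x n = word x' n -> f n x / f n x' <= B.

Definition Zpart k (S : set (sq k)) (f : nat -> sq k -> R) (n : nat) : R :=
  \sum_(w : n.-tuple 'I_k.+1 | `[< allowable S (tval w) >])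
     sup [set f n x | x in S `&` cyl (tval w)].

Definition pressure k (S : set (sq k)) (f : nat -> sq k -> R) : R :=
  lim ((fun n : nat => n.+1%:R^-1 * ln (Zpart S f n.+1) : R) @ \oo).

Definition invariant_prob k (S : set (sq k))
  (mu : {measure set (sqm k) -> \bar R}) : Prop :=
  [/\ mu setT = 1%E, mu S = 1%E &
      forall A : set (sqm k), measurable A ->
        mu ((@shift k) @^-1` A) = mu A].

Definition gibbs k (S : set (sq k)) (f : nat -> sq k -> R)
  (mu : {measure set (sqm k) -> \bar R}) : Prop :=
  exists C0 : R, 0 < C0 /\ forall x n, S x -> (0 < n)%N ->
    ((C0^-1 * (expR (- n%:R * pressure S f) * f n x))%:E
       < mu (cyl (word x n)) < (C0 * (expR (- n%:R * pressure S f) * f n x))%:E)%E.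

(* measure-theoretic entropy h_mu(sigma) of an invariant measure on the
   shift, computed w.r.t. the generating partition into 1-cylinders *)
Definition entropy k (mu : {measure set (sqm k) -> \bar R}) : R :=
  lim ((fun n : nat => n.+1%:R^-1 *
     \sum_(w : n.+1.-tuple 'I_k.+1)
        (- (fine (mu (cyl (tval w))) * ln (fine (mu (cyl (tval w)))))) : R) @ \oo).

Definition lyap k (S : set (sq k)) (f : nat -> sq k -> R)
  (mu : {measure set (sqm k) -> \bar R}) : R :=
  lim ((fun n : nat => n.+1%:R^-1 *
     fine (\int[mu]_(x in (S : set (sqm k))) (ln (f n.+1 x))%:E) : R) @ \oo).

Definition var_pressure k (S : set (sq k)) (f : nat -> sq k -> R) : R :=
  sup [set entropy mu + lyap S f mu | mu in [set mu | invariant_prob S mu]].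

End Potentials.

(* Main.v *)
(** Put P = pressure Y f and b(y) = nu[y].  The weight a(w) = b(pi w) / |pi^-1[pi w]|
    on the words w of X has total mass 1 in each length, and Condition A makes it
    quasi-Bernoulli: a(u v) is comparable to a(u) a(v) when u v is allowable.  As
    e^(-nP) g_n is comparable to a, this already gives pressure X g = P, and the
    Gibbs measures of g are the invariant measures comparable to a on cylinders.

    Existence: extend w by i letters on the left and on the right up to total length
    2N, sum a over the extensions, average over i < N and take an ultrafilter limit.
    Uniqueness: specification gives mu (C /\ shift^-n B) >= d mu C mu B for a cylinder C
    of length n - p, so every set containing its preimage has measure 0 or 1; this is
    applied to the union of the preimages of a Hahn set of the difference of two
    Gibbs measures.  The projection of mu is invariant and bounded by K nu, hence
    equal to nu by the same argument.  Both variational pressures equal P by the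
    inequality -x ln x + x ln y <= y - x, with equality up to O(1) for Gibbs measures. *)

Require Import Defs.
From HB Require Import structures.
From mathcomp Require Import all_boot all_order all_algebra.
From mathcomp Require Import all_classical all_reals all_analysis.
From mathcomp Require Import measurable_realfun zify lra ring.
Import Order.TTheory GRing.Theory Num.Theory numFieldNormedType.Exports.
Import Defs.
Local Open Scope classical_set_scope.
Local Open Scope ring_scope.

Set Implicit Arguments.
Unset Strict Implicit.
Unset Printing Implicit Defensive.

(** * Words and sofic shifts *)

(** Once [nu] is replaced by its cylinder weights, measures and pressures see the potentials only
    through two-sided bounds by a weight on words, so limits and suprema become estimates on finite
    sums. The weight on [X] need not be additive under extension of a word, since fiber counts are
    multiplicative only up to a constant. This is why the Gibbs measure on [X] has to be produced as
    a limit of averages and cannot be read off from the weight.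

    Condition A bounds the weight of a concatenation from above; the bound from below comes from the
    submultiplicativity of the fiber counts. Specification acts through its fixed gap length: there
    are finitely many connecting words, hence a positive minimal weight.

    [pressure], [entropy] and [lyap] are defined by [lim], so each identity about them includes a
    proof of convergence, obtained from subadditivity or from an O(1) deviation from linear
    growth. *)

Section WordSums.
Variables (R : realType) (k : nat).
Local Notation A := 'I_k.+1.

(** The summand is defined on all words rather than on tuples, so that sums over concatenations
    split without casts. *)
Definition wsum n (F : seq A -> R) : R := \sum_(w : n.-tuple A) F w.

Lemma eq_wsum n F G : (forall w, size w = n -> F w = G w) -> wsum n F = wsum n G.
Proof. by move=> FG; apply: eq_bigr => w _; rewrite FG ?size_tuple. Qed.

Lemma ler_wsum n F G : (forall w, size w = n -> F w <= G w) -> wsum n F <= wsum n G.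
Proof. by move=> FG; apply: ler_sum => w _; rewrite FG ?size_tuple. Qed.

Lemma wsum_ge0 n F : (forall w, size w = n -> 0 <= F w) -> 0 <= wsum n F.
Proof. by move=> FG; apply: sumr_ge0 => w _; rewrite FG ?size_tuple. Qed.

Lemma wsumD n F G : wsum n (fun w => F w + G w) = wsum n F + wsum n G.
Proof. exact: big_split. Qed.

Lemma wsumZ n c F : wsum n (fun w => c * F w) = c * wsum n F.
Proof. by rewrite /wsum big_distrr. Qed.

Lemma wsumZr n c F : wsum n (fun w => F w * c) = wsum n F * c.
Proof. by rewrite /wsum big_distrl. Qed.

Lemma wsum0 F : wsum 0 F = F [::].
Proof.
rewrite /wsum (bigD1 [tuple]) //= big1 ?addr0 // => w.
by move=> /eqP[]; apply: val_inj => /=; rewrite (tuple0 w).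
Qed.

Lemma wsumS n F : wsum n.+1 F = \sum_s wsum n (fun w => F (s :: w)).
Proof.
rewrite /wsum pair_big /=.
rewrite (reindex (fun sw : A * n.-tuple A => [tuple of sw.1 :: sw.2])) //=.
exists (fun w => (thead w, [tuple of behead w])) => [[s w] _|w _] /=.
  by rewrite theadE; congr pair; exact: val_inj.
by rewrite [w in RHS]tuple_eta.
Qed.

Lemma wsum1 F : wsum 1 F = \sum_s F [:: s].
Proof. by rewrite wsumS; apply: eq_bigr => s _; rewrite wsum0. Qed.

Lemma wsum_cat n m F : wsum (n + m) F = wsum n (fun u => wsum m (fun v => F (u ++ v))).
Proof.
elim: n F => [|n IH] F; first by rewrite wsum0.
by rewrite addSn !wsumS; apply: eq_bigr => s _; rewrite IH.
Qed.

Lemma ler_wsum1 n F w : size w = n -> (forall v, 0 <= F v) -> F w <= wsum n F.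
Proof.
move=> sw F0; rewrite /wsum (bigD1 (tcast sw (in_tuple w))) //=.
have -> : tval (tcast sw (in_tuple w)) = w by case: _ / sw.
by rewrite lerDl sumr_ge0.
Qed.

End WordSums.

Lemma exchange_wsum (R : realType) (k k' n m : nat)
    (F : seq 'I_k.+1 -> seq 'I_k'.+1 -> R) :
  wsum n (fun u => wsum m (F u)) = wsum m (fun v => wsum n (F^~ v)).
Proof. exact: exchange_big. Qed.

Section Sequences.
Variable k : nat.
Local Notation A := 'I_k.+1.
Implicit Types (x y : sq k) (u v w : seq A) (S : set (sq k)).

Lemma size_word x n : size (word x n) = n.
Proof. exact: size_mkseq. Qed.

Lemma iter_shiftE x n i : iter n (@shift k) x i = x (n + i)%N.
Proof.
elim: n x i => // n IH x i.
by rewrite iterS /shift IH addSnnS.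
Qed.

Lemma word_cat x n m : word x (n + m) = word x n ++ word (iter n (@shift k) x) m.
Proof.
rewrite /word /mkseq iotaD map_cat add0n; congr (_ ++ _).
rewrite -{1}[n]addn0 iotaDl -map_comp; apply: eq_map => i /=.
by rewrite iter_shiftE.
Qed.

Lemma take_word x n m : (n <= m)%N -> take n (word x m) = word x n.
Proof. by move=> nm; rewrite -(subnKC nm) word_cat take_size_cat ?size_word. Qed.

Lemma eq_word_le x y n m : (n <= m)%N -> word x m = word y m -> word x n = word y n.
Proof. by move=> nm xy; rewrite -(take_word x nm) -(take_word y nm) xy. Qed.

Lemma eq_wordP x y n : word x n = word y n <-> forall i, (i < n)%N -> x i = y i.
Proof.
split=> [xy i ni|xy].
  by rewrite -(nth_mkseq ord0 x ni) -(nth_mkseq ord0 y ni) -/(word x n) xy.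
by apply/eq_in_map => i; rewrite mem_iota => /xy.
Qed.

Lemma cyl_word x n : cyl (word x n) x.
Proof. by rewrite /cyl /= size_word. Qed.

Lemma cylP w n x : size w = n -> cyl w x <-> word x n = w.
Proof. by move=> <-. Qed.

Lemma cyl_nil : cyl (@nil A) = setT.
Proof. by rewrite eqEsubset; split. Qed.

Lemma cyl_cat u v x :
  cyl (u ++ v) x <-> cyl u x /\ cyl v (iter (size u) (@shift k) x).
Proof.
rewrite /cyl /= size_cat word_cat; split; last by case=> -> ->.
move/eqP; rewrite eqseq_cat ?size_word // => /andP[/eqP-> /eqP->] //.
Qed.

Lemma cyl_catE u v : cyl (u ++ v) = cyl u `&` iter (size u) (@shift k) @^-1` cyl v.
Proof. by apply/seteqP; split=> x /cyl_cat. Qed.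

Lemma blockmap_word l (p : A -> 'I_l.+1) x n :
  word (blockmap p x) n = map p (word x n).
Proof. by rewrite /word /mkseq -map_comp. Qed.

Definition shift_closed S := forall x, S x -> S (shift x).

(** Closedness in the product topology, expressed through allowable words. Together with
    [shift_closed] it is what soficity contributes to the proof. *)
Definition word_closed S := forall x, (forall n, allowable S (word x n)) -> S x.

Lemma shift_closed_iter S n x : shift_closed S -> S x -> S (iter n (@shift k) x).
Proof. by move=> hS; elim: n => //= n IH Sx; apply/hS/IH. Qed.

Lemma allowable_word S x n : S x -> allowable S (word x n).
Proof. by exists x => //; exact: cyl_word. Qed.

Lemma allowable_catl S u v : allowable S (u ++ v) -> allowable S u.
Proof. by case=> x Sx /cyl_cat[xu _]; exists x. Qed.

Lemma allowable_catr S u v : shift_closed S -> allowable S (u ++ v) -> allowable S v.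
Proof.
move=> hS [x Sx /cyl_cat[_ xv]].
by exists (iter (size u) (@shift k) x) => //; exact: shift_closed_iter.
Qed.

Lemma ultra_symbol (U : set_system nat) (g : nat -> A) :
  UltraFilter U -> exists s, U [set n | g n = s].
Proof.
move=> UU; apply: contrapT => /forallNP h.
have : \forall n \near U, forall s, ~ (g n = s).
  apply: filter_forall => s.
  by case: (in_ultra_setVsetC [set n | g n = s] UU) => // /h.
by move=> /filter_ex[n /(_ (g n))].
Qed.

(** Compactness of the full shift: an ultrafilter selects a letter at each position, and a prefix
    involves finitely many positions. *)
Lemma ultra_limit (U : set_system nat) (z : nat -> sq k) : UltraFilter U ->
  exists x, forall N, \forall n \near U, word (z n) N = word x N.
Proof.
move=> UU; have /choice[x hx] := fun i => ultra_symbol (fun n => z n i) UU.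
exists x => N.
have : \forall n \near U, forall i : 'I_N, z n i = x i.
  by apply: filter_forall => i; exact: hx.
apply: filterS => n h; apply/eq_wordP => i iN; exact: (h (Ordinal iN)).
Qed.

Lemma oo_ultra : exists U : set_system nat, UltraFilter U /\ \oo `<=` U.
Proof. exact: ultraFilterLemma. Qed.

End Sequences.

Lemma SFT_shift k (F : seq (seq 'I_k.+1)) : shift_closed (SFT F).
Proof. by move=> x Fx i w wF; have := Fx i.+1 w wF; rewrite iterSr. Qed.

Lemma sofic_shift k (X : set (sq k)) : sofic X -> shift_closed X.
Proof.
move=> [k' [F [phi [phiX phis _]]]] x; rewrite -phiX => -[z Fz <-].
by exists (shift z); [exact: SFT_shift | rewrite phis].
Qed.

(** The prefixes of [x] lift to points of the subshift of finite type. An ultrafilter limit of these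
    avoids the forbidden words, which are finite, and continuity of [phi] identifies its image with
    [x]. *)
Lemma sofic_closed k (X : set (sq k)) : sofic X -> word_closed X.
Proof.
move=> [k' [F [phi [phiX phis phic]]]] x hx.
have /choice[z hz] : forall n, exists z, SFT F z /\ word (phi z) n = word x n.
  move=> n; have [y] := hx n; rewrite -phiX => -[z Fz <-] /cylP-/(_ n).
  by rewrite size_word => /(_ erefl) h; exists z.
have [U [UU ooU]] := oo_ultra.
have [z0 hz0] := ultra_limit z UU.
have Fz0 : SFT F z0.
  move=> i w wF h.
  (* An occurrence of [w] in the limit is visible in a prefix of length [i + size w], which some
     [z n] shares. *)
  have [n hn] := filter_ex (hz0 (i + size w)%N).
  apply: ((hz n).1 i w wF); move: hn; rewrite !word_cat h.
  by move/eqP; rewrite eqseq_cat ?size_word // => /andP[_ /eqP].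
rewrite -phiX; exists z0 => //; apply/funext => i.
have [M hM] := phic z0 i.+1 Fz0.
(* [n] must exceed [i], as [phi (z n)] is known to agree with [x] only on the first [n] letters. *)
have : \forall n \near U, (i < n)%N /\ word (z n) M = word z0 M.
  by apply: filterI (hz0 M); apply: ooU; exact: nbhs_infty_gt.
move=> /filter_ex[n [ni hn]].
have /eq_wordP/(_ i (ltnSn i)) -> := hM _ (hz n).1 (esym hn).
by have /eq_wordP/(_ i ni) := (hz n).2.
Qed.

(** * Measures determined by their cylinder weights *)

Definition pushforward_measure d d' (T1 : measurableType d) (T2 : measurableType d')
    (R : realType) (mu : {measure set T1 -> \bar R}) (f : T1 -> T2)
    (mf : measurable_fun setT f) : {measure set T2 -> \bar R} :=
  measure_function_pushforward__canonical__measure_function_Measure mu mf.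

Lemma measure_bigsetU_fin d (R : realType) (T : measurableType d)
    (mu : {measure set T -> \bar R}) (I : finType) (P : pred I) (F : I -> set T) :
  (forall i, measurable (F i)) ->
  (forall i j x, P i -> P j -> F i x -> F j x -> i = j) ->
  mu (\big[setU/set0]_(i | P i) F i) = (\sum_(i | P i) mu (F i))%E.
Proof.
move=> mF tF; rewrite -big_filter -[RHS]big_filter.
have := filter_uniq P (index_enum_uniq I).
have : all P [seq i <- index_enum I | P i] by exact: filter_all.
elim: [seq i <- index_enum I | P i] => [|i s IH] /=; first by rewrite !big_nil measure0.
move=> /andP[Pi aP] /andP[is_ us]; rewrite !big_cons measureU //.
- by congr (_ + _)%E; exact: IH.
- by apply: bigsetU_measurable => j _.
apply/seteqP; split=> x //= -[Fx]; rewrite -bigcup_seq => -[j js Fj].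
by move: is_; rewrite (tF _ _ _ Pi _ Fx Fj) ?js // (allP aP).
Qed.

Section CylinderMeasures.
Variables (R : realType) (k : nat).
Local Notation A := 'I_k.+1.
Implicit Types (mu : {measure set (sqm k) -> \bar R}) (w u v : seq A) (S : set (sq k)).

Lemma measurable_cyl w : measurable (cyl w : set (sqm k)).
Proof. by apply: sub_sigma_algebra; exists w. Qed.

Lemma cyl_split (B : set (sq k)) n :
  B = \big[setU/set0]_(w : n.-tuple A) (B `&` cyl w).
Proof.
apply/seteqP; split=> x; rewrite -bigcup_seq; last by move=> [w _ []].
move=> Bx; exists [tuple of word x n]; first by rewrite /= mem_index_enum.
by split => //; exact: cyl_word.
Qed.

Lemma eq_cyl (n : nat) (u v : n.-tuple A) x : cyl u x -> cyl v x -> u = v.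
Proof.
move=> /(cylP _ (size_tuple u)) ux /(cylP _ (size_tuple v)) vx.
by apply: val_inj; rewrite /= -ux -vx.
Qed.

Lemma measurable_cyl_closed S : word_closed S -> measurable (S : set (sqm k)).
Proof.
move=> Sc.
have -> : S = \bigcap_n \big[setU/set0]_(w : n.-tuple A | `[< allowable S w >]) cyl w.
  apply/seteqP; split=> [x Sx n _|x hx].
    rewrite -bigcup_seq_cond; exists [tuple of word x n]; last exact: cyl_word.
    by rewrite /= mem_index_enum; apply/asboolP; exact: allowable_word.
  apply: Sc => n; have := hx n I; rewrite -bigcup_seq_cond => -[w /= /andP[_ /asboolP aw]].
  by move/(cylP _ (size_tuple w)) => ->.
apply: bigcapT_measurable => n; apply: bigsetU_measurable => w _.
exact: measurable_cyl.
Qed.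

Lemma measurable_shift : measurable_fun setT (@shift k : sqm k -> sqm k).
Proof.
apply: (@measurability _ _ _ (sqm k) setT _ (@cylinders k)) => // _ [_ [w _ <-] <-]; rewrite setTI.
rewrite (_ : _ @^-1` _ = \big[setU/set0]_(s : A) cyl (s :: w)).
  by apply: bigsetU_measurable => s _; exact: measurable_cyl.
apply/seteqP; split=> x; rewrite -bigcup_seq /=.
  move=> xw; exists (x 0) => //=; first by rewrite mem_index_enum.
  by rewrite -cat1s; apply/cyl_cat; split.
by move=> [s _]; rewrite -cat1s => /cyl_cat[].
Qed.

Lemma measurable_iter_shift n : measurable_fun setT (iter n (@shift k) : sqm k -> sqm k).
Proof.
elim: n => [|n IH]; first exact: measurable_id.
exact: (measurableT_comp measurable_shift IH).
Qed.

Lemma measurable_iter_shift_preimage n (B : set (sqm k)) :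
  measurable B -> measurable (iter n (@shift k) @^-1` B : set (sqm k)).
Proof. by move=> mB; rewrite -[X in measurable X]setTI; exact: measurable_iter_shift. Qed.

Lemma measurable_blockmap l (p : A -> 'I_l.+1) :
  measurable_fun setT (blockmap p : sqm k -> sqm l).
Proof.
apply: (@measurability _ _ _ (sqm l) setT _ (@cylinders l)) => // _ [_ [w _ <-] <-]; rewrite setTI.
rewrite (_ : _ @^-1` _ =
    \big[setU/set0]_(v : (size w).-tuple A | map p v == w) cyl v).
  by apply: bigsetU_measurable => s _; exact: measurable_cyl.
apply/seteqP; split=> x; rewrite -bigcup_seq_cond /=.
  rewrite /cyl /= blockmap_word => xw; exists [tuple of word x (size w)].
    by rewrite /= mem_index_enum xw eqxx.
  exact: cyl_word.
move=> [v /= /andP[_ /eqP vw]]; rewrite /cyl /= size_tuple.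
by rewrite blockmap_word => ->.
Qed.

Lemma measure_wsum mu (B : set (sqm k)) n : measurable B ->
  mu B = (\sum_(w : n.-tuple A) mu (B `&` cyl w))%E.
Proof.
move=> mB; rewrite {1}(cyl_split B n); apply: measure_bigsetU_fin.
  by move=> w; apply: measurableI => //; exact: measurable_cyl.
by move=> u v x _ _ [_ ux] [_ vx]; exact: eq_cyl ux vx.
Qed.

(** Two cylinders are nested or disjoint; with the empty set added they form a generating family
    closed under intersection. *)
Lemma measure_cyl_unique mu1 mu2 : (mu1 setT < +oo)%E ->
  (forall w, mu1 (cyl w) = mu2 (cyl w)) ->
  forall B : set (sqm k), measurable B -> mu1 B = mu2 B.
Proof.
move=> foo h B mB.
apply: (@measure_unique _ R (sqm k) (@cylinders k `|` [set set0]) (fun=> setT)) => //.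
- apply/seteqP; split; first by apply: sub_sigma_algebra2 => ?; left.
  apply: smallest_sub; first exact: smallest_sigma_algebra.
  move=> C [CC|->]; first exact: sub_sigma_algebra.
  exact: (@measurable0 _ (sqm k)).
- have H u v : (size u <= size v)%N -> cyl u `&` cyl v = cyl v \/ cyl u `&` cyl v = set0 :> set (sq k).
    move=> uv; have [tu|tu] := eqVneq (take (size u) v) u.
      by left; rewrite -[v](cat_take_drop (size u)) tu cyl_catE setIA setIid.
    right; apply/seteqP; split=> x // -[xu xv]; move/eqP: tu; apply.
    by rewrite /cyl /= in xu xv; rewrite -xv take_word.
  move=> C D [[u _ <-]|->] [[v _ <-]|->]; rewrite ?setI0 ?set0I; try by right.
  have [uv|/ltnW vu] := leqP (size u) (size v).
    by case: (H _ _ uv) => ->; [left; exists v | right].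
  by rewrite setIC; case: (H _ _ vu) => ->; [left; exists u | right].
- by move=> _; left; exists [::] => //; exact: cyl_nil.
- by apply/seteqP; split=> // x _; exists 0.
- by move=> C [[w _ <-]|->]; rewrite ?measure0.
Qed.

End CylinderMeasures.

(** * Construction of a measure with prescribed cylinder weights *)

Section WeightMeasure.
Variables (R : realType) (k : nat).
Local Notation A := 'I_k.+1.
Variable m : seq A -> R.
Hypothesis m_ge0 : forall w, 0 <= m w.
Hypothesis m_rcons : forall w, m w = \sum_s m (rcons w s).

Let psum w (j : nat) := \sum_(i : A | (i < j)%N) m (rcons w i).

Let psum0 w : psum w 0 = 0. Proof. by rewrite /psum big1. Qed.

Let psumS w (s : A) : psum w s.+1 = psum w s + m (rcons w s).
Proof.
rewrite /psum (bigD1 s) //= addrC; congr (_ + _); apply: eq_bigl => i.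
by rewrite ltnS andbC ltn_neqAle.
Qed.

Let psum_le w i j : (i <= j)%N -> psum w i <= psum w j.
Proof.
move=> ij; rewrite /psum [leRHS](bigID (fun a : A => (a < i)%N)) /=.
rewrite [X in _ <= X + _](eq_bigl (fun a : A => (a < i)%N)).
  by rewrite lerDl sumr_ge0.
by move=> a; rewrite andbC; case: ltnP => //= ai; rewrite (leq_trans ai ij).
Qed.

Let psumT w : psum w k.+1 = m w.
Proof. by rewrite m_rcons /psum; apply: eq_bigl => i; rewrite ltn_ord. Qed.

(** Left endpoint of the interval of [w]: the mass of the words of the same length that precede [w]
    lexicographically. *)
Let lo w := \sum_(i < size w) psum (take i w) (nth ord0 w i).

Let lo_rcons w s : lo (rcons w s) = lo w + psum w s.
Proof.
rewrite /lo size_rcons big_ord_recr /= nth_rcons ltnn eqxx.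
have -> : take (size w) (rcons w s) = w by rewrite -cats1 take_size_cat.
congr (_ + _); apply: eq_bigr => i _.
by rewrite nth_rcons ltn_ord -cats1 takel_cat // ltnW.
Qed.

(* The words of length n cut [0, m [::][ into half-open intervals of length m w,
   refining each other as n grows. *)
Let itvw w := [pred t : R | lo w <= t < lo w + m w].

Let itvw_rconsW w s t : itvw (rcons w s) t -> itvw w t.
Proof.
rewrite /= lo_rcons => /andP[h1 h2]; apply/andP; split.
  by apply: le_trans h1; rewrite lerDl -(psum0 w) psum_le.
apply: (lt_le_trans h2); rewrite -addrA -psumS lerD2l -psumT psum_le //.
Qed.

Let itvw_rcons_ex w t : itvw w t -> exists s, itvw (rcons w s) t.
Proof.
move=> /= /andP[h1 h2].
have ex : exists j, (t - lo w < psum w j.+1).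
  by exists k; rewrite psumT ltrBlDl.
case: (ex_minnP ex) => j hj jmin.
have jk : (j < k.+1)%N by rewrite ltnS; apply: jmin; rewrite psumT ltrBlDl.
exists (Ordinal jk) => /=; rewrite lo_rcons -addrA -psumS /=.
rewrite -ltrBlDl hj andbT -lerBrDl.
case: j {ex} hj jmin jk => [|j] hj jmin jk; first by rewrite psum0 subr_ge0.
by rewrite leNgt; apply/negP => /jmin; rewrite ltnn.
Qed.

Let itvw_rcons_uniq w s s' t : itvw (rcons w s) t -> itvw (rcons w s') t -> s = s'.
Proof.
wlog : s s' / (s <= s')%N => [hw|].
  move=> h h'; have [ss'|/ltnW ss'] := leqP s s'; first exact: hw.
  by apply/esym; exact: hw.
rewrite leq_eqVlt => /orP[/eqP/val_inj//|ss'].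
move=> /= /andP[_ h1] /andP[h2 _]; have := le_lt_trans h2 h1.
by rewrite !lo_rcons -addrA -psumS ltrD2l ltNge psum_le.
Qed.

(** Letter of the subinterval that contains [t]; [ord0] is a default, reached for every [t] outside
    the base interval [itvw [::]]. *)
Let sym t w : A := odflt ord0 [pick s | itvw (rcons w s) t].

Let tw t := fix tw n := if n is n'.+1 then rcons (tw n') (sym t (tw n')) else [::].

Let tseq t : sq k := fun n => sym t (tw t n).

Let word_tseq t n : word (tseq t) n = tw t n.
Proof.
elim: n => // n IH; have := word_cat (tseq t) n 1; rewrite addn1 => ->.
by rewrite /= -cats1 IH /word /mkseq /= iter_shiftE addn0.
Qed.

Let itvw_tw t n : itvw [::] t -> itvw (tw t n) t.
Proof.
move=> h0; elim: n => //= n /itvw_rcons_ex[s hs].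
by rewrite /sym; case: pickP => [//|/(_ s)]; rewrite hs.
Qed.

Let tw_itvw t w : itvw w t -> tw t (size w) = w.
Proof.
elim/last_ind: w => //= w s IH h; rewrite size_rcons /= IH; last exact: itvw_rconsW h.
congr rcons; rewrite /sym; case: pickP => [s' hs' /=|hn]; last by move: (hn s) h => /= ->.
exact: itvw_rcons_uniq hs' h.
Qed.

Let itvw_nil t w : itvw w t -> itvw [::] t.
Proof. by elim/last_ind: w => // w s IH /itvw_rconsW. Qed.

Let tseq_cyl t w : itvw [::] t -> cyl w (tseq t) <-> itvw w t.
Proof.
move=> h0; rewrite /cyl /= word_tseq; split=> [<-|/tw_itvw//].
exact: itvw_tw.
Qed.

Let sym_out t w : ~~ itvw [::] t -> sym t w = ord0.
Proof.
by move=> h; rewrite /sym; case: pickP => // s /itvw_nil; rewrite (negbTE h).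
Qed.

Let itvwE w : [set t | itvw w t] = `[lo w, lo w + m w[%classic.
Proof. by apply/seteqP; split=> t; rewrite /= in_itv. Qed.

Let measurable_itvw w : measurable [set t : measurableTypeR R | itvw w t].
Proof. by rewrite itvwE; exact: measurable_itv. Qed.

Let measurable_tseq :
  measurable_fun setT (tseq : measurableTypeR R -> sqm k).
Proof.
apply: (@measurability _ _ _ (sqm k) setT _ (@cylinders k)) => // _ [_ [w _ <-] <-]; rewrite setTI.
(* Outside the base interval [tseq] is the constant sequence [ord0], so the complement lies in the
   preimage or misses it as a whole. *)
have -> : tseq @^-1` cyl w = [set t | itvw w t] `|`
    (if `[< cyl w (fun=> ord0 : A) >] then ~` [set t | itvw [::] t] else set0).
  apply/seteqP; split=> t /=.
    have [h0|h0] := boolP (itvw [::] t); first by move=> /tseq_cyl-/(_ h0) ?; left.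
    have -> : tseq t = (fun=> ord0) by apply/funext => i; exact: sym_out.
    by move=> h; right; case: asboolP => //= _; apply/negP.
  move=> [h|]; first by apply/tseq_cyl => //; exact: itvw_nil h.
  case: asboolP => //= h /negP h0.
  by have -> : tseq t = (fun=> ord0) by apply/funext => i; exact: sym_out.
apply: measurableU; first exact: measurable_itvw.
by case: ifP => // _; apply: measurableC; exact: measurable_itvw.
Qed.

(** Kolmogorov extension by coding reals: [tseq] records the nested intervals that contain [t], and
    the image of Lebesgue measure on the base interval gives each cylinder the length of its
    interval. *)
Lemma weight_measure :
  exists mu : {measure set (sqm k) -> \bar R}, forall w, mu (cyl w) = (m w)%:E.
Proof.
(* Restricting to the base interval discards the reals that [tseq] codes by default. *)
pose mu0 := measure_function_mrestr__canonical__measure_function_Measure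
  (@lebesgue_measure R) (measurable_itvw [::]).
exists (pushforward_measure mu0 measurable_tseq).
move=> w; rewrite /= /pushforward /mu0 /= /mrestr.
have -> : tseq @^-1` cyl w `&` [set t | itvw [::] t] = `[lo w, lo w + m w[%classic.
  rewrite -itvwE; apply/seteqP; split=> t /= => [[h h0]|h]; first exact/tseq_cyl.
  by split; [apply/tseq_cyl => // |]; exact: itvw_nil h.
rewrite lebesgue_measure_itv /= lte_fin ltrDl.
have := m_ge0 w; rewrite le_eqVlt => /orP[/eqP<-|->]; first by rewrite ltxx.
by rewrite -EFinD addrAC subrr add0r.
Qed.

End WeightMeasure.

Section CylinderWeights.
Variables (R : realType) (k : nat).
Local Notation A := 'I_k.+1.
Implicit Types (mu : {measure set (sqm k) -> \bar R}) (B : set (sqm k)).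

Definition wt mu (w : seq A) : R := fine (mu (cyl w)).

Lemma finite_measure_num mu B : (mu setT < +oo)%E -> measurable B ->
  mu B \is a fin_num.
Proof.
move=> foo mB; rewrite ge0_fin_numE //; apply: le_lt_trans foo.
by apply: le_measure => //; rewrite inE.
Qed.

Lemma wtE mu w : (mu setT < +oo)%E -> (wt mu w)%:E = mu (cyl w).
Proof. by move=> foo; rewrite fineK // finite_measure_num //; exact: measurable_cyl. Qed.

Lemma wt_ge0 mu w : 0 <= wt mu w.
Proof. by rewrite fine_ge0. Qed.

Lemma fine_measure_wsum mu B n : (mu setT < +oo)%E -> measurable B ->
  fine (mu B) = wsum n (fun w => fine (mu (B `&` cyl w))).
Proof.
move=> foo mB; rewrite (measure_wsum mu n mB) /wsum -sum_fine // => w _.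
by apply: finite_measure_num => //; apply: measurableI => //; exact: measurable_cyl.
Qed.

Lemma wt_catr mu n w : (mu setT < +oo)%E ->
  wt mu w = wsum n (fun v => wt mu (w ++ v)).
Proof.
move=> foo; rewrite {1}/wt (fine_measure_wsum (size w + n) foo (measurable_cyl w)).
rewrite wsum_cat (@eq_wsum _ _ _ _ (fun u => (u == w)%:R * wsum n (fun v => wt mu (u ++ v)))).
  rewrite /wsum (bigD1 (in_tuple w)) //= eqxx mul1r [X in _ + X]big1 ?addr0 // => u uw.
  rewrite (_ : (_ == _) = false) ?mul0r //; apply/negbTE.
  by apply: contra uw => /eqP h; apply/eqP/val_inj.
move=> u su; rewrite -wsumZ; apply: eq_wsum => v sv.
have [->|uw] := eqVneq u w.
  rewrite mul1r /wt cyl_catE setIA setIid //.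
rewrite mul0r (_ : _ `&` _ = set0) ?measure0 //.
apply/seteqP; split=> x // -[xw /cyl_cat[xu _]]; move/eqP: uw; apply.
by move: xu; rewrite /cyl /= su => <-.
Qed.

Lemma wt_rcons mu w : (mu setT < +oo)%E -> wt mu w = \sum_s wt mu (rcons w s).
Proof.
move=> foo; rewrite (wt_catr 1 w foo) wsum1; apply: eq_bigr => s _.
by rewrite cats1.
Qed.

Lemma wt_nil mu : wt mu [::] = fine (mu setT).
Proof. by rewrite /wt cyl_nil. Qed.

Lemma wsum_wt mu n : (mu setT < +oo)%E -> wsum n (wt mu) = fine (mu setT).
Proof. by move=> foo; rewrite -wt_nil (wt_catr n _ foo). Qed.

(* The differences mu2 (cyl w) - mu1 (cyl w) are the weights of a measure mu3,
   and mu1 + mu3 = mu2 by uniqueness. *)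
Lemma le_measure_cyl mu1 mu2 : (mu2 setT < +oo)%E ->
  (forall w, (mu1 (cyl w) <= mu2 (cyl w))%E) ->
  forall B, measurable B -> (mu1 B <= mu2 B)%E.
Proof.
move=> foo2 h B mB.
have foo1 : (mu1 setT < +oo)%E.
  by have := h [::]; rewrite cyl_nil => /le_lt_trans; exact.
have [||mu3 hmu3] := @weight_measure R k (fun w => wt mu2 w - wt mu1 w).
- by move=> w; rewrite subr_ge0 -lee_fin !wtE.
- by move=> w; rewrite (wt_rcons w foo2) (wt_rcons w foo1) -sumrB.
have -> : mu2 B = measure_add mu1 mu3 B.
  apply: measure_cyl_unique => // w.
  by rewrite /= [RHS]measure_addE hmu3 -!wtE // -EFinD addrC subrK.
by rewrite measure_addE leeDl.
Qed.

End CylinderWeights.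

Section InvariantMeasures.
Variables (R : realType) (k : nat).
Local Notation A := 'I_k.+1.
Variables (S : set (sq k)) (mu : {measure set (sqm k) -> \bar R}).
Hypotheses (Sc : word_closed S) (muS : invariant_prob S mu).

Lemma invariant_prob_fin : (mu setT < +oo)%E.
Proof. by case: muS => -> _ _; rewrite ltry. Qed.

Let foo := invariant_prob_fin.

Lemma invariant_iter n (B : set (sqm k)) : measurable B ->
  mu (iter n (@shift k) @^-1` B) = mu B.
Proof.
case: muS => _ _ inv mB; elim: n => // n IH.
rewrite -[RHS]IH -[RHS]inv //; last exact: measurable_iter_shift_preimage.
congr (mu _); apply/seteqP; split=> x /=; by rewrite -iterSr.
Qed.

(** Extension to the right, [wt_catr], holds for every finite measure; extension to the left
    expresses shift invariance. *)
Lemma wt_catl n w : wt mu w = wsum n (fun u => wt mu (u ++ w)).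
Proof.
rewrite /wt -(invariant_iter n (measurable_cyl w)).
rewrite (fine_measure_wsum n foo); last first.
  by apply: measurable_iter_shift_preimage; exact: measurable_cyl.
by apply: eq_wsum => u su; rewrite cyl_catE setIC su.
Qed.

Lemma wsum_wt1 n : wsum n (wt mu) = 1.
Proof. by rewrite wsum_wt //; case: muS => h _ _; exact: (congr1 fine h). Qed.

Lemma wt_supp w : ~ allowable S w -> wt mu w = 0.
Proof.
move=> h; apply/eqP; rewrite eq_le wt_ge0 andbT.
have mS := measurable_cyl_closed Sc.
have : (mu (cyl w) <= mu (~` S))%E.
  apply: le_measure; rewrite ?inE; first exact: measurable_cyl.
    exact: measurableC.
  by move=> x xw Sx; apply: h; exists x.
have [m1 m2 _] := muS.
have -> : mu (~` S) = 0%E.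
  have e : (mu (setT `\` S) = mu setT - mu (setT `&` S))%E by apply: measureD.
  by move: e; rewrite setTI setTD m2 => ->; rewrite m1 -EFinB subrr.
by rewrite -wtE // lee_fin.
Qed.

End InvariantMeasures.

(** * Uniqueness of Gibbs measures *)

Section GibbsWeights.
Variables (R : realType) (k : nat).
Local Notation A := 'I_k.+1.
Implicit Types (S : set (sq k)) (a : seq A -> R).

(** The mass is one in every length, but no consistency between lengths is asked: a lifted weight
    need not be the sum of its one-letter extensions. *)
Definition gibbs_weight S a : Prop :=
  [/\ forall w, allowable S w -> 0 < a w,
      forall w, ~ allowable S w -> a w = 0,
      forall n, wsum n a = 1 &
      exists c : R, 0 < c /\ forall u v, allowable S (u ++ v) ->
        c * (a u * a v) <= a (u ++ v) <= c^-1 * (a u * a v)].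

Lemma gibbs_weight_ge0 S a w : gibbs_weight S a -> 0 <= a w.
Proof.
case=> a0 aN _ _; have [/a0/ltW//|/aN->//] := pselect (allowable S w).
Qed.

(** An empty word is padded with a letter that is dropped after the connection has been made; the
    gap length stays the same. *)
Lemma specification_nil S : shift_closed S -> specification S ->
  exists p : nat, forall u v, allowable S u -> allowable S v ->
    exists s, size s = p /\ allowable S (u ++ s ++ v).
Proof.
move=> hS [p [p0 spec]]; exists p => u v.
have letter w : allowable S w -> exists b : A, allowable S [:: b].
  by case=> x Sx _; exists (x 0); exact: (allowable_word 1 Sx).
have spec1 u' v' : (0 < size u')%N -> allowable S u' -> allowable S v' ->
    exists s, size s = p /\ allowable S (u' ++ s ++ v').
  case: v' => [|b v'] su au av; last by apply: spec.
  have [b ab] := letter _ av; have [s [sp]] := spec u' [:: b] su isT au ab.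
  by rewrite catA => /allowable_catl; exists s; rewrite cats0.
case: u => [|b u] au av; last by apply: spec1.
have [b ab] := letter _ av; have [s [sp]] := spec1 [:: b] v isT ab av.
by move=> /(allowable_catr hS); exists s.
Qed.

Lemma gibbs_weight_min S a p : gibbs_weight S a ->
  exists d : R, 0 < d /\ forall w, size w = p -> allowable S w -> d <= a w.
Proof.
case=> a0 _ _ _.
exists (\big[Num.min/1]_(w : p.-tuple A | `[< allowable S w >]) a w); split.
  by apply: lt_bigmin => // w /asboolP /a0.
move=> w sw aw; pose t := tcast sw (in_tuple w).
have tw : tval t = w by rewrite /t; clear t; case: _ / sw.
rewrite -[in leRHS]tw; apply: bigmin_le_cond; rewrite tw; exact/asboolP.
Qed.

(** One connecting word is enough: its weight is at least the minimum over the finitely many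
    allowable words of length [p]. *)
Lemma gibbs_weight_mixing S a : shift_closed S -> specification S ->
  gibbs_weight S a ->
  exists p (d : R), 0 < d /\ forall u v,
    d * (a u * a v) <= wsum p (fun s => a (u ++ s ++ v)).
Proof.
move=> hS /(specification_nil hS)[p spec] ga.
have [d [d0 hd]] := gibbs_weight_min p ga.
have a_ge0 w := gibbs_weight_ge0 w ga.
case: (ga) => a0 aN _ [c [c0 hc]].
(* One factor [c] for each cut, after [u] and after [s]; [d] bounds the weight of [s]. *)
exists p, (c * c * d); split; first by rewrite !mulr_gt0.
move=> u v.
have [au|/aN->] := pselect (allowable S u); last first.
  by rewrite mul0r mulr0 wsum_ge0.
have [av|/aN->] := pselect (allowable S v); last first.
  by rewrite !mulr0 wsum_ge0.
have [s [sp asv]] := spec u v au av.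
apply: (@le_trans _ _ (a (u ++ s ++ v))); last first.
  by apply: (@ler_wsum1 _ _ _ (fun s => a (u ++ s ++ v))).
have /andP[+ _] := hc _ _ asv; apply: le_trans.
have -> : c * c * d * (a u * a v) = c * (a u * (c * (d * a v))) by ring.
rewrite ler_pM2l // ler_wpM2l //.
have as' := allowable_catr hS asv.
have /andP[+ _] := hc _ _ as'; apply: le_trans.
by rewrite ler_pM2l // ler_wpM2r // hd //; exact: allowable_catl as'.
Qed.

End GibbsWeights.

Section FiniteMeasureCopy.
Variables (R : realType) (k : nat) (mu : {measure set (sqm k) -> \bar R}).
Hypothesis foo : (mu setT < +oo)%E.

(* Carries the finite_measure structure that mu lacks. *)
Definition finite_copy of (mu setT < +oo)%E : set (sqm k) -> \bar R := mu.

HB.instance Definition _ := isMeasure.Build _ _ _ (finite_copy foo)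
  (measure0 mu) (@measure_ge0 _ _ _ mu) (@measure_semi_sigma_additive _ _ _ mu).

Let finite_copy_fin : fin_num_fun (finite_copy foo).
Proof. by move=> B mB; exact: finite_measure_num. Qed.

HB.instance Definition _ := Measure_isFinite.Build _ _ _ (finite_copy foo) finite_copy_fin.

End FiniteMeasureCopy.

Section Uniqueness.
Variables (R : realType) (k : nat).
Local Notation A := 'I_k.+1.

Lemma fineDI (mu : {measure set (sqm k) -> \bar R}) (B C : set (sqm k)) :
  (mu setT < +oo)%E -> measurable B -> measurable C ->
  fine (mu B) = fine (mu (B `&` C)) + fine (mu (B `\` C)).
Proof.
move=> foo mB mC.
have mI : measurable (B `&` C) by exact: measurableI.
have mD : measurable (B `\` C) by exact: measurableD.
rewrite -fineD; try exact: finite_measure_num.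
congr fine; rewrite -{1}(setUIDK B C) measureU //.
by apply/seteqP; split=> x // [[_ ?] [_ ?]].
Qed.

Lemma fine_le_measure (mu : {measure set (sqm k) -> \bar R}) (B C : set (sqm k)) :
  (mu setT < +oo)%E -> measurable B -> measurable C -> B `<=` C ->
  fine (mu B) <= fine (mu C).
Proof.
move=> foo mB mC BC; apply: fine_le; try exact: finite_measure_num.
by apply: le_measure; rewrite ?inE.
Qed.

Lemma hahn_finite_measures (mu1 mu2 : {measure set (sqm k) -> \bar R}) :
  (mu1 setT < +oo)%E -> (mu2 setT < +oo)%E ->
  exists P : set (sqm k), [/\ measurable P,
    (forall B, measurable B -> B `<=` P -> fine (mu2 B) <= fine (mu1 B)) &
    (forall B, measurable B -> B `<=` ~` P -> fine (mu1 B) <= fine (mu2 B))].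
Proof.
move=> foo1 foo2.
pose sg : {charge set (sqm k) -> \bar R} :=
  cadd (charge_of_finite_measure (finite_copy foo1))
       (cscale (-1) (charge_of_finite_measure (finite_copy foo2))).
have sgE B : measurable B -> sg B = (fine (mu1 B) - fine (mu2 B))%:E.
  move=> mB; rewrite /sg /= /cadd /= /cscale /= /charge_of_finite_measure /finite_copy.
  by rewrite mulN1e EFinB !fineK //; exact: finite_measure_num.
have [P [N [[mP posP] [mN negN] PN PN0]]] := Hahn_decomposition sg.
exists P; split=> // B mB BP.
  by have := posP B mB BP; rewrite sgE // lee_fin subr_ge0.
have BN : B `<=` N.
  by move=> x /BP nP; have : setT x by []; rewrite -PN => -[].
by have := negN B mB BN; rewrite sgE // lee_fin subr_le0.
Qed.

Let wt_sum_cyl (mu : {measure set (sqm k) -> \bar R}) p u v : (mu setT < +oo)%E ->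
  mu (iter (size u + p) (@shift k) @^-1` cyl v `&` cyl u) =
  (wsum p (fun s => wt mu (u ++ s ++ v)))%:E.
Proof.
move=> foo.
have -> : iter (size u + p) (@shift k) @^-1` cyl v `&` cyl u =
    \big[setU/set0]_(s : p.-tuple A) cyl (u ++ s ++ v).
  apply/seteqP; split=> x; rewrite -bigcup_seq /=.
    move=> [xv xu]; exists [tuple of word (iter (size u) (@shift k) x) p].
      by rewrite /= mem_index_enum.
    apply/cyl_cat; split => //; apply/cyl_cat; split; first exact: cyl_word.
    by rewrite size_word -iterD addnC.
  move=> [s _ /cyl_cat[xu /cyl_cat[_]]].
  by rewrite size_tuple -iterD addnC.
rewrite (measure_bigsetU_fin mu).
- by rewrite /wsum -sumEFin; apply: eq_bigr => s _; rewrite wtE.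
- by move=> s; exact: measurable_cyl.
move=> s s' x _ _ /cyl_cat[_ /cyl_cat[h _]] /cyl_cat[_ /cyl_cat[h' _]].
exact: eq_cyl h h'.
Qed.

Section Ergodicity.
Variables (mu : {measure set (sqm k) -> \bar R}) (p : nat) (e : R).
Hypotheses (foo : (mu setT < +oo)%E) (e0 : 0 < e).
Hypothesis mixing : forall u v,
  e * (wt mu u * wt mu v) <= wsum p (fun s => wt mu (u ++ s ++ v)).

(** For fixed [u] both sides are measures in [B], so it suffices to compare them on cylinders, where
    the inequality is [mixing]. *)
Let mixing_cyl u (B : set (sqm k)) : measurable B ->
  ((e * wt mu u)%:E * mu B <= mu (iter (size u + p) (@shift k) @^-1` B `&` cyl u))%E.
Proof.
move=> mB; have eu : 0 <= e * wt mu u by rewrite mulr_ge0 ?wt_ge0 ?ltW.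
pose m2 := pushforward_measure (measure_function_mrestr__canonical__measure_function_Measure
  mu (measurable_cyl u)) (@measurable_iter_shift k (size u + p)).
have -> : mu (iter (size u + p) (@shift k) @^-1` B `&` cyl u) = m2 B by [].
have -> : ((e * wt mu u)%:E * mu B)%E = mscale (NngNum eu) mu B by [].
apply: le_measure_cyl => //.
  rewrite /m2 /= /pushforward /= /mrestr preimage_setT setTI -wtE // ltry //.
move=> v; rewrite /m2 /= /pushforward /= /mrestr /mscale /= wt_sum_cyl //.
by rewrite -wtE // -EFinM lee_fin -mulrA.
Qed.

(** Since the preimages of [U] lie in [U], the mixing bound loses its shift: the part of [B] in [U]
    has measure at least [e] mu(U) mu(B), for cylinders and hence for all [B]. Taking the complement
    of [U] as [B] makes mu(U) mu(B) vanish. *)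
Lemma mixing_zero_one (U : set (sqm k)) : measurable U ->
  @shift k @^-1` U `<=` U -> mu U = 0%E \/ mu (~` U) = 0%E.
Proof.
move=> mU sU.
have sUn n : iter n (@shift k) @^-1` U `<=` U.
  by elim: n => // n IH x h; apply: IH; exact: sU h.
have eU : 0 <= e * fine (mu U) by apply: mulr_ge0; [exact: ltW | exact: fine_ge0].
have h (B : set (sqm k)) : measurable B ->
    ((e * fine (mu U))%:E * mu B <= mu (B `&` U))%E.
  move=> mB.
  pose m2 := measure_function_mrestr__canonical__measure_function_Measure mu mU.
  have -> : mu (B `&` U) = m2 B by [].
  have -> : ((e * fine (mu U))%:E * mu B)%E = mscale (NngNum eU) mu B by [].
  apply: le_measure_cyl => //.
    rewrite /m2 /= /mrestr setTI; rewrite -ge0_fin_numE //.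
    exact: finite_measure_num.
  move=> u; rewrite /m2 /= /mrestr /mscale /=.
  have := mixing_cyl u mU; rewrite -(wtE _ foo) -(fineK (finite_measure_num foo mU)) //.
  rewrite -!EFinM (mulrAC e) => /le_trans; apply.
  rewrite setIC; apply: le_measure; rewrite ?inE.
  - apply: measurableI; first exact: measurable_cyl.
    exact: measurable_iter_shift_preimage.
  - by apply: measurableI => //; exact: measurable_cyl.
  - by apply: setIS; exact: sUn.
have := h _ (measurableC mU); rewrite setIC setICr measure0.
rewrite -(fineK (finite_measure_num foo (measurableC mU))) -EFinM lee_fin.
rewrite -mulrA pmulr_rle0 // => h0.
have : fine (mu U) * fine (mu (~` U)) == 0.
  by rewrite eq_le h0 mulr_ge0 ?fine_ge0.
rewrite mulf_eq0 => /orP[] /eqP h1; [left|right].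
  by rewrite -(fineK (finite_measure_num foo mU)) h1.
by rewrite -(fineK (finite_measure_num foo (measurableC mU))) h1.
Qed.

End Ergodicity.

End Uniqueness.

Section UniquenessOfGibbs.
Variables (R : realType) (k : nat).
Local Notation A := 'I_k.+1.
Implicit Types (mu : {measure set (sqm k) -> \bar R}) (B : set (sqm k)).

Lemma le_measure_weight mu1 mu2 (K : R) : (mu1 setT < +oo)%E -> (mu2 setT < +oo)%E ->
  0 <= K -> (forall w, wt mu1 w <= K * wt mu2 w) ->
  forall B, measurable B -> fine (mu1 B) <= K * fine (mu2 B).
Proof.
move=> foo1 foo2 K0 h B mB.
rewrite -lee_fin EFinM !fineK ?finite_measure_num //.
have -> : (K%:E * mu2 B)%E = mscale (NngNum K0) mu2 B by [].
apply: le_measure_cyl => //.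
  by rewrite /= /mscale /= -(fineK (finite_measure_num foo2 measurableT)) -EFinM ltry.
by move=> w; rewrite /= /mscale /= -!wtE // -EFinM lee_fin.
Qed.

(** On subsets of [P] the difference mu1 - mu2 is nonnegative; its total on [P] is zero, so no
    subset can carry a positive part. *)
Lemma eq_measure_dominated mu1 mu2 (P : set (sqm k)) :
  (mu1 setT < +oo)%E -> (mu2 setT < +oo)%E -> measurable P ->
  (forall B, measurable B -> B `<=` P -> fine (mu2 B) <= fine (mu1 B)) ->
  fine (mu1 P) = fine (mu2 P) ->
  forall B, measurable B -> B `<=` P -> fine (mu1 B) = fine (mu2 B).
Proof.
move=> foo1 foo2 mP h hP B mB BP; apply/eqP; rewrite eq_le h // andbT.
have := h (P `\` B) (measurableD mP mB) (@subDsetl _ P B).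
move: hP; rewrite (fineDI foo1 mP mB) (fineDI foo2 mP mB) setIC setIidl //.
lra.
Qed.

(** Of [mu1] only an upper bound is asked, so that the projection of a Gibbs measure qualifies. The
    difference of the measures takes the same value on the Hahn set [P] and on [U]; the zero-one law
    for [mu2] and the domination of [mu1] make it vanish there. *)
Lemma gibbs_unique S (a : seq A -> R) (K : R) mu1 mu2 :
  shift_closed S -> specification S -> gibbs_weight S a -> 0 < K ->
  invariant_prob S mu1 -> invariant_prob S mu2 ->
  (forall w, wt mu1 w <= K * a w) ->
  (forall w, a w <= K * wt mu2 w) -> (forall w, wt mu2 w <= K * a w) ->
  forall B, measurable B -> mu1 B = mu2 B.
Proof.
move=> hS spec ga K0 inv1 inv2 h1 h2 h2'.
have foo1 := invariant_prob_fin inv1; have foo2 := invariant_prob_fin inv2.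
have [p [d [d0 hd]]] := gibbs_weight_mixing hS spec ga.
have a_ge0 w := gibbs_weight_ge0 w ga.
have mixing u v : d / (K * K * K) * (wt mu2 u * wt mu2 v) <=
    wsum p (fun s => wt mu2 (u ++ s ++ v)).
  have -> : d / (K * K * K) * (wt mu2 u * wt mu2 v) =
    K^-1 * (d * ((K^-1 * wt mu2 u) * (K^-1 * wt mu2 v))) by field; lra.
  have e w : K^-1 * wt mu2 w <= a w by rewrite mulrC ler_pdivrMr // mulrC.
  apply: (@le_trans _ _ (K^-1 * (d * (a u * a v)))).
    rewrite ler_pM2l ?invr_gt0 // ler_pM2l //.
    have K'0 : 0 <= K^-1 by rewrite invr_ge0 ltW.
    by rewrite ler_pM // mulr_ge0 ?wt_ge0.
  apply: (@le_trans _ _ (K^-1 * wsum p (fun s => a (u ++ s ++ v)))).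
    by rewrite ler_pM2l ?invr_gt0.
  rewrite mulrC ler_pdivrMr // mulrC -wsumZ; apply: ler_wsum => w _.
  exact: h2.
have dom B : measurable B -> fine (mu1 B) <= K * K * fine (mu2 B).
  apply: le_measure_weight => //; first by rewrite ltW ?mulr_gt0.
  move=> w; apply: le_trans (h1 w) _; rewrite -mulrA ler_pM2l //.
have [P [mP hP hN]] := hahn_finite_measures foo1 foo2.
pose Q j := iter j (@shift k) @^-1` P.
have mQ j : measurable (Q j : set (sqm k)) by exact: measurable_iter_shift_preimage.
have invQ mu j : invariant_prob S mu -> fine (mu (Q j)) = fine (mu P).
  by move=> inv; rewrite (invariant_iter inv).
have mQP j : measurable (Q j `\` P : set (sqm k)) by exact: measurableD.
(* With delta = mu1 - mu2, invariance gives delta(Q j) = delta(P), hence delta(Q j \ P) = delta(P \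
   Q j). The first is at most 0 and the second at least 0. *)
have QP j : fine (mu1 (Q j `\` P)) = fine (mu2 (Q j `\` P)).
  apply/eqP; rewrite eq_le hN //.
  have mPQ : measurable (P `\` Q j : set (sqm k)) by exact: measurableD.
  have := hP _ mPQ (@subDsetl _ P _).
  have := invQ mu1 j inv1; have := invQ mu2 j inv2.
  rewrite (fineDI foo1 (mQ j) mP) (fineDI foo2 (mQ j) mP).
  rewrite (fineDI foo1 mP (mQ j)) (fineDI foo2 mP (mQ j)) (setIC (Q j)).
  by move=> ? ? ?; apply/andP; split=> //; lra.
pose U := \bigcup_j Q j.
have mU : measurable (U : set (sqm k)) by exact: bigcupT_measurable.
have PU : P `<=` U by move=> x Px; exists 0.
(* The pieces are made disjoint; each lies in some [Q j \ P], where the two measures agree on all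
   measurable subsets. *)
have UP : fine (mu1 (U `\` P)) = fine (mu2 (U `\` P)).
  have -> : U `\` P = \bigcup_j seqDU (fun j => Q j `\` P) j.
    by rewrite -seqDU_bigcup_eq -setI_bigcupl.
  have mS j : measurable (seqDU (fun j => Q j `\` P) j : set (sqm k)).
    by apply: measurableD => //; apply: bigsetU_measurable.
  congr fine; rewrite !measure_bigcup //=; try exact: trivIset_seqDU.
  apply: eq_eseriesr => j _.
  rewrite -(fineK (finite_measure_num foo1 (mS j))) -(fineK (finite_measure_num foo2 (mS j))).
  congr EFin; apply/esym.
  apply: (eq_measure_dominated foo2 foo1 (mQP j)) => //.
  - by move=> B mB BQ; apply: hN => // x /BQ[].
  - by move=> x [].
have mNP : measurable (~` P : set (sqm k)) by exact: measurableC.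
have mNU : measurable (~` U : set (sqm k)) by exact: measurableC.
have m1T : fine (mu1 setT) = 1 by case: inv1 => ->.
have m2T : fine (mu2 setT) = 1 by case: inv2 => ->.
have eqU : fine (mu1 U) = fine (mu2 U).
  have sU : @shift k @^-1` U `<=` U.
    by move=> x [j _ h]; exists j.+1 => //; rewrite /Q /= -iterS iterSr.
  have dK : 0 < d / (K * K * K) by rewrite divr_gt0 ?mulr_gt0.
  (* Either [U] or its complement is null for [mu2], hence also for [mu1] by [dom]. *)
  have [U0|U0] := mixing_zero_one foo2 dK mixing mU sU.
    have := dom _ mU; rewrite U0 /= mulr0 => h.
    by apply/eqP; rewrite eq_le h fine_ge0.
  have := dom _ mNU; rewrite U0 /= mulr0 => h.
  have h0 : 0 <= fine (mu1 (~` U)) by rewrite fine_ge0.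
  have := m1T; have := m2T.
  rewrite (fineDI foo1 measurableT mU) (fineDI foo2 measurableT mU) setTI setTD U0 /=.
  lra.
have eqP1 : fine (mu1 P) = fine (mu2 P).
  move: eqU; rewrite (fineDI foo1 mU mP) (fineDI foo2 mU mP) UP setIC setIidl //.
  by move/addIr.
have eqN1 : fine (mu1 (~` P)) = fine (mu2 (~` P)).
  have := m1T; have := m2T.
  rewrite (fineDI foo1 measurableT mP) (fineDI foo2 measurableT mP) setTI setTD.
  lra.
move=> B mB.
rewrite -(fineK (finite_measure_num foo1 mB)) -(fineK (finite_measure_num foo2 mB)).
congr EFin; rewrite (fineDI foo1 mB mP) (fineDI foo2 mB mP).
congr (_ + _).
  by apply: (eq_measure_dominated foo1 foo2 mP) => //; exact: measurableI.
apply/esym; apply: (eq_measure_dominated foo2 foo1 mNP) => //; first exact: measurableD.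
Qed.

End UniquenessOfGibbs.

(** * Existence of Gibbs measures *)

Lemma ultra_cvg (R : realType) (U : set_system nat) (u : nat -> R) (M : R) :
  UltraFilter U -> (\forall n \near U, 0 <= u n <= M) -> exists l : R, u @ U --> l.
Proof.
move=> UU hu.
have [l [_ hl]] : `[0, M]%classic `&` cluster (u @ U) !=set0.
  by apply: segment_compact; apply: filterS hu => n; rewrite /= in_itv.
exists l => B lB; have [//|hB] := in_ultra_setVsetC (u @^-1` B) UU.
by have [x []] := hl _ _ (hB : (u @ U) (~` B)) lB.
Qed.

Lemma cvg_sum_fin (R : realType) (T : Type) (F : set_system T) (I : finType)
    (f : I -> T -> R) (l : I -> R) : Filter F ->
  (forall i, f i @ F --> l i) -> (fun n => \sum_i f i n) @ F --> \sum_i l i.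
Proof.
move=> FF h; elim: (index_enum I) => [|i s IH].
  by under eq_fun do rewrite big_nil; rewrite big_nil; exact: cvg_cst.
by under eq_fun do rewrite big_cons; rewrite big_cons; exact: cvgD.
Qed.

(** An ultrafilter finer than [\oo] does not see errors of order 1/n; this removes the end terms of
    the averages in [gibbs_exists]. *)
Lemma ultra_lim_eq (R : realType) (U : set_system nat) (u v : nat -> R) (x y C : R) :
  UltraFilter U -> \oo `<=` U -> 0 <= C -> u @ U --> x -> v @ U --> y ->
  (\forall n \near \oo, `|u n - v n| <= C * n.+1%:R^-1) -> x = y.
Proof.
move=> UU ooU C0 ux vy h.
have uv : (fun n => `|u n - v n|) @ U --> `|x - y| by apply: cvg_norm; exact: cvgB.
have H n0 : `|x - y| <= C * @harmonic R n0.
  apply: (cvgr_to_le uv); apply: ooU.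
  apply: filterS2 h (nbhs_infty_ge n0) => n + n0n; move=> /le_trans; apply.
  by rewrite ler_wpM2l // lef_pV2 ?posrE ?ltr0n // ler_nat.
have : C * @harmonic R n @[n --> \oo] --> C * 0 by apply: cvgM; [exact: cvg_cst | exact: cvg_harmonic].
rewrite mulr0 => hl.
have : `|x - y| <= 0 by apply: (cvgr_to_ge hl); exact: nearW.
by rewrite normr_le0 subr_eq0 => /eqP.
Qed.

Section Existence.
Variables (R : realType) (k : nat).
Local Notation A := 'I_k.+1.
Variables (S : set (sq k)) (a : seq A -> R).
Hypotheses (hS : shift_closed S) (hSc : word_closed S).
Hypotheses (spec : specification S) (ga : gibbs_weight S a).

Let a_ge0 w : 0 <= a w := gibbs_weight_ge0 w ga.

(** Summing over a letter appended to [w] amounts to one more letter of right extension, and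
    likewise on the left; this replaces the additivity that [a] may lack. *)
Let b i j w := wsum i (fun u => wsum j (fun v => a (u ++ w ++ v))).

Let b_ge0 i j w : 0 <= b i j w.
Proof. by apply: wsum_ge0 => u _; apply: wsum_ge0. Qed.

Let b_rcons i j w : \sum_s b i j (rcons w s) = b i j.+1 w.
Proof.
rewrite /b; transitivity (wsum 1 (fun s => wsum i (fun u => wsum j (fun v => a (u ++ w ++ s ++ v))))).
  rewrite wsum1; apply: eq_bigr => s _; apply: eq_wsum => u _; apply: eq_wsum => v _.
  by rewrite cat_rcons.
by rewrite exchange_wsum; apply: eq_wsum => u _; rewrite -(add1n j) wsum_cat.
Qed.

Let b_cons i j w : \sum_s b i j (s :: w) = b i.+1 j w.
Proof.
rewrite /b; transitivity (wsum 1 (fun s => wsum i (fun u => wsum j (fun v => a (u ++ s ++ w ++ v))))).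
  by rewrite wsum1; apply: eq_bigr => s _; apply: eq_wsum => u _; apply: eq_wsum => v _.
rewrite exchange_wsum -(addn1 i) wsum_cat; apply: eq_wsum => u _; apply: eq_wsum => s _.
by apply: eq_wsum => v _; rewrite -catA.
Qed.

Let a1 n : wsum n a = 1. Proof. by case: ga. Qed.

(** The two cuts cost [c^-1] each, and the extensions sum to mass one, so the constant is
    independent of [i] and [j]. *)
Let b_upper : exists M : R, 0 < M /\ forall i j w, b i j w <= M * a w.
Proof.
have [_ aN _ [c [c0 hc]]] := ga.
have ac u v : a (u ++ v) <= c^-1 * (a u * a v).
  have [/hc/andP[]//|/aN->] := pselect (allowable S (u ++ v)).
  by rewrite !mulr_ge0 ?invr_ge0 // ltW.
have ci : 0 < c^-1 by rewrite invr_gt0.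
exists (c^-1 * c^-1); split; first by rewrite mulr_gt0.
move=> i j w.
apply: (@le_trans _ _ (wsum i (fun u => a u * (c^-1 * c^-1 * a w)))); last first.
  by rewrite wsumZr a1 mul1r.
apply: ler_wsum => u _.
apply: (@le_trans _ _ (wsum j (fun v => a u * (c^-1 * c^-1 * a w) * a v))); last first.
  by rewrite wsumZ a1 mulr1.
apply: ler_wsum => v _; apply: (le_trans (ac _ _)).
have -> : a u * (c^-1 * c^-1 * a w) * a v = c^-1 * (a u * (c^-1 * (a w * a v))) by ring.
by rewrite ler_pM2l // ler_wpM2l.
Qed.

(** The [p] letters of each extension next to [w] serve as connecting words, which is why both
    extensions must have length at least [p]. *)
Let b_lower : exists p (d : R), 0 < d /\ forall i j w, (p <= i)%N -> (p <= j)%N ->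
  d * a w <= b i j w.
Proof.
have [p [d [d0 hd]]] := gibbs_weight_mixing hS spec ga.
exists p, (d * d); split; first by rewrite mulr_gt0.
move=> i j w pi pj.
have hl i' x : d * a x <= wsum (i' + p) (fun u => a (u ++ x)).
  rewrite wsum_cat; apply: (@le_trans _ _ (wsum i' (fun u => a u * (d * a x)))).
    by rewrite wsumZr a1 mul1r.
  apply: ler_wsum => u _; rewrite mulrCA; apply: le_trans (hd _ _) _.
  by apply: ler_wsum => s _; rewrite -catA.
have hr j' x : d * a x <= wsum (p + j') (fun v => a (x ++ v)).
  rewrite wsum_cat exchange_wsum; apply: (@le_trans _ _ (wsum j' (fun v => d * a x * a v))).
    by rewrite wsumZ a1 mulr1.
  by apply: ler_wsum => u _; rewrite -mulrA; apply: hd.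
rewrite /b exchange_wsum; apply: (@le_trans _ _ (wsum j (fun v => d * a (w ++ v)))).
  by rewrite wsumZ -mulrA ler_pM2l // -(subnKC pj); exact: hr.
by apply: ler_wsum => v _; rewrite -(subnK pi); exact: hl.
Qed.

Lemma gibbs_exists : exists (mu : {measure set (sqm k) -> \bar R}) (K : R),
  [/\ invariant_prob S mu, 0 < K, forall w, wt mu w <= K * a w &
      forall w, a w <= K * wt mu w].
Proof.
have [M [M0 bM]] := b_upper; have [p [d [d0 bd]]] := b_lower.
have [U [UU ooU]] := oo_ultra.
(* All the words u ++ w ++ v occurring in avg N w have length 2N, which makes
   avg N consistent under right extension, and under left extension up to the
   two end terms of the average. *)
pose avg N w := N.+1%:R^-1 * \sum_(i < N.+1) b (i + p) (N + N - (i + p) - size w) w.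
have N0 N : 0 < N.+1%:R^-1 :> R by rewrite invr_gt0 ltr0n.
have avg_ge0 N w : 0 <= avg N w.
  by rewrite mulr_ge0 ?(ltW (N0 _)) // sumr_ge0.
have avg_le N w : avg N w <= M * a w.
  rewrite /avg mulrC ler_pdivrMr ?ltr0n //.
  apply: (@le_trans _ _ (\sum_(i < N.+1) M * a w)); first exact: ler_sum.
  by rewrite sumr_const card_ord mulr_natr.
have avg_ge w : \forall N \near U, d * a w <= avg N w.
  (* For [i <= N] the right extension has at least [N - p - size w] letters, and [b_lower] asks for
     [p] of them. *)
  apply: ooU; exists (p + p + size w)%N => // N /= hN.
  rewrite /avg [leRHS]mulrC ler_pdivlMr ?ltr0n //.
  apply: (@le_trans _ _ (\sum_(i < N.+1) d * a w)).
    by rewrite sumr_const card_ord mulr_natr.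
  apply: ler_sum => i _; apply: bd; first exact: leq_addl.
  have := ltn_ord i; rewrite ltnS => iN.
  lia.
have /choice[m hm] : forall w, exists l : R, avg^~ w @ U --> l.
  move=> w; apply: (@ultra_cvg R U _ (M * a w)) => //.
  by apply: nearW => N; rewrite avg_ge0 avg_le.
have m_le w : m w <= M * a w.
  by apply: (cvgr_to_le (hm w)); apply: nearW.
have m_ge w : d * a w <= m w by exact: (cvgr_to_ge (hm w)).
have m_ge0 w : 0 <= m w by apply: le_trans (m_ge w); rewrite mulr_ge0 // ltW.
have avg_rcons N w : (p + size w < N)%N -> \sum_s avg N (rcons w s) = avg N w.
  move=> hN; rewrite /avg -big_distrr /= exchange_big /=; congr (_ * _).
  apply: eq_bigr => i _.
  have iN := ltn_ord i.
  rewrite -(subnSK (_ : (size w < N + N - (i + p))%N)) -?b_rcons; last lia.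
  by apply: eq_bigr => s _; rewrite size_rcons.
have avg_cons N w : (p + size w < N)%N ->
    `|\sum_s avg N (s :: w) - avg N w| <= M * a w * N.+1%:R^-1.
  move=> hN; rewrite /avg -big_distrr /= exchange_big /= -mulrBr.
  pose F i := b (i + p) (N + N - (i + p) - size w) w.
  (* A letter in front of [w] moves the summand from index [i] to [i + 1]: the left extension grows
     while the total length stays 2N, so the difference telescopes. *)
  rewrite (eq_bigr (fun i : 'I_N.+1 => F i.+1)); last first.
    move=> i _; have iN := ltn_ord i.
    by rewrite /F addSn -b_cons; apply: eq_bigr => s _ /=; congr (b _ _ _); lia.
  have -> : \sum_(i < N.+1) F i.+1 - \sum_(i < N.+1) F i = F N.+1 - F 0.
    by rewrite big_ord_recr [X in _ - X]big_ord_recl /=; ring.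
  rewrite normrM gtr0_norm // mulrC ler_pM2r //.
  have F0 i : 0 <= F i <= M * a w by rewrite b_ge0 bM.
  by rewrite ler_norml; have := F0 0; have := F0 N.+1; lra.
have m_rcons w : m w = \sum_s m (rcons w s).
  apply/esym; apply: (@ultra_lim_eq R U _ _ _ _ 0 UU ooU _ (cvg_sum_fin _ (fun s => hm (rcons w s))) (hm w)) => //.
  exists (p + size w).+1 => // N hN.
  by rewrite avg_rcons // subrr normr0 mul0r.
have m_cons w : m w = \sum_s m (s :: w).
  apply/esym; apply: (@ultra_lim_eq R U _ _ _ _ (M * a w) UU ooU _ (cvg_sum_fin _ (fun s => hm (s :: w))) (hm w)) => //.
    by rewrite mulr_ge0 // ltW.
  exists (p + size w).+1 => // N hN; exact: avg_cons.
have m_nil : m [::] = 1.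
  apply: (@ultra_lim_eq R U _ (fun=> 1) _ _ 0 UU ooU _ (hm [::]) (cvg_cst _)) => //.
  exists p.+1 => // N hN.
  rewrite (_ : avg N [::] = 1) ?subrr ?normr0 ?mul0r // /avg.
  rewrite (eq_bigr (fun=> 1)); first by rewrite sumr_const card_ord mulVf ?pnatr_eq0.
  move=> i _; have iN := ltn_ord i.
  by rewrite /b -(@wsum_cat _ _ _ _ a) a1.
have [mu hmu] := weight_measure m_ge0 m_rcons.
have wtm w : wt mu w = m w by rewrite /wt hmu.
have muT : mu setT = 1%E by rewrite -(cyl_nil k) hmu m_nil.
have foo : (mu setT < +oo)%E by rewrite muT ltry.
have aN : forall w, ~ allowable S w -> a w = 0 by case: ga.
(* A single constant for both comparisons: [M] for the upper one, [d^-1] for the lower one. *)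
exists mu, (M + d^-1); split.
- split => //.
  + have muN w : ~ allowable S w -> mu (cyl w) = 0%E.
      move=> /aN w0; rewrite hmu; congr EFin; apply/eqP.
      by rewrite eq_le m_ge0 (le_trans (m_le w)) // w0 mulr0.
    have mS := measurable_cyl_closed hSc.
    have : mu (~` S) = 0%E.
      (* By closedness a point outside [S] has a prefix that is not allowable, and the cylinders of
         such prefixes have weight 0. *)
      have -> : ~` S = \bigcup_n \big[setU/set0]_(w : n.-tuple A | ~~ `[< allowable S w >]) cyl w.
        apply/seteqP; split=> x.
          move=> Sx; apply: contrapT => h; apply: Sx; apply: hSc => n.
          apply: contrapT => hn; apply: h; exists n => //; rewrite -bigcup_seq_cond.
          exists [tuple of word x n]; last exact: cyl_word.
          by rewrite /= mem_index_enum; apply/asboolPn.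
        move=> [n _]; rewrite -bigcup_seq_cond => -[w /= /andP[_ /asboolPn aw]] xw Sx.
        by apply: aw; exists x.
      have mB n : measurable (\big[setU/set0]_(w : n.-tuple A | ~~ `[< allowable S w >]) cyl w : set (sqm k)).
        by apply: bigsetU_measurable => w _; exact: measurable_cyl.
      apply/(@negligibleP _ _ _ mu); first exact: bigcupT_measurable.
      apply: negligible_bigcup => n; apply/(@negligibleP _ _ _ mu) => //.
      apply: (etrans (measure_bigsetU_fin mu _ _)).
      * by move=> w; exact: measurable_cyl.
      * by move=> u v x _ _; exact: eq_cyl.
      * by apply: big1 => w /asboolPn; exact: muN.
    have e : (mu setT = mu S + mu (~` S))%E.
      by have := measureU mu mS (measurableC mS) (setICr S); rewrite setUCr.
    by move=> h; move: e; rewrite h adde0 => <-; exact: muT.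
  + move=> B mB.
    have -> : mu (@shift k @^-1` B) = pushforward_measure mu (@measurable_shift k) B by [].
    apply/esym; apply: measure_cyl_unique => // w.
    rewrite hmu m_cons /= /pushforward.
    have mw : measurable (@shift k @^-1` cyl w : set (sqm k)).
      by rewrite -[X in measurable X]setTI; apply: measurable_shift => //; exact: measurable_cyl.
    rewrite -(fineK (finite_measure_num foo mw)) (fine_measure_wsum 1 foo mw) wsum1.
    congr EFin; apply: eq_bigr => s _.
    by rewrite -wtm /wt -cat1s cyl_catE setIC.
- by rewrite addr_gt0 ?invr_gt0.
- move=> w; rewrite wtm; apply: le_trans (m_le w) _.
  by rewrite ler_wpM2r // lerDl invr_ge0 ltW.
- move=> w; rewrite wtm mulrDl; apply: (@le_trans _ _ (d^-1 * m w)).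
    by rewrite mulrC ler_pdivlMr // mulrC.
  by rewrite lerDr mulr_ge0 // ltW.
Qed.

End Existence.

(** * Pressure and the variational principle *)

(** The limit is the infimum of [E], which the linear lower bound keeps finite. *)
Lemma fekete (R : realType) (u : nat -> R) (K : R) :
  (forall n m, (0 < n)%N -> (0 < m)%N -> u (n + m)%N <= u n + u m) ->
  (forall n, (0 < n)%N -> - (n%:R * K) <= u n) ->
  cvg ((fun n => n.+1%:R^-1 * u n.+1) @ \oo).
Proof.
move=> subadd lb.
pose E := [set n.+1%:R^-1 * u n.+1 | n in [set: nat]].
have n0 n : 0 < n.+1%:R :> R by rewrite ltr0n.
have EI : has_inf E.
  split; first by exists (1%:R^-1 * u 1); exists 0.
  exists (- K) => _ [n _ <-].
  rewrite [leRHS]mulrC ler_pdivlMr // mulrC mulrN; exact: lb.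
apply/cvg_ex; exists (inf E).
apply/cvgrPdist_lt => e e0.
have e2 : 0 < e / 2 by rewrite divr_gt0.
have [_ [m _ <-] tm] := inf_adherent e2 EI.
set t := m.+1%:R^-1 * u m.+1 in tm.
(* Subtracting the slope [t] keeps subadditivity and makes [v] vanish at [m.+1], so [v] is bounded
   above by its values on remainders. *)
pose v n := u n - n%:R * t.
have vadd n n' : (0 < n)%N -> (0 < n')%N -> v (n + n')%N <= v n + v n'.
  by move=> h h'; rewrite /v natrD; have := subadd n n' h h'; lra.
have vm : v m.+1 = 0 by rewrite /v /t mulrA mulfV ?pnatr_eq0 // mul1r subrr.
have vr q r : (0 < r)%N -> v (q * m.+1 + r)%N <= v r.
  move=> r0; elim: q => [|q IH]; first by rewrite mul0n add0n.
  rewrite mulSn -addnA; apply: le_trans (vadd _ _ _ _) _ => //; first by rewrite addn_gt0 r0 orbT.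
  by rewrite vm add0r.
(* Remainders run from 1 to [m.+1] instead of 0 to [m], because subadditivity is assumed for
   positive arguments. *)
pose C := \sum_(r < m.+2) `|v r|.
have vC n : v n.+1 <= C.
  rewrite [n in v n.+1](divn_eq n m.+1) -addnS; apply: (le_trans (vr _ _ _)) => //.
  have hr : ((n %% m.+1).+1 < m.+2)%N by rewrite ltnS ltn_mod.
  apply: (le_trans (ler_norm _)); rewrite /C (bigD1 (Ordinal hr)) //=.
  by rewrite lerDl sumr_ge0.
have hC : \forall n \near \oo, C * n.+1%:R^-1 < e / 2.
  have : C * @harmonic R n @[n --> \oo] --> C * 0.
    by apply: cvgM; [exact: cvg_cst | exact: cvg_harmonic].
  by rewrite mulr0 => h; exact: (cvgr_lt _ h).
apply: filterS hC => n hn.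
have lo : inf E <= n.+1%:R^-1 * u n.+1.
  by apply: ge_inf; [exact: EI.2 | exists n].
have hi : n.+1%:R^-1 * u n.+1 <= t + C * n.+1%:R^-1.
  rewrite [leLHS]mulrC ler_pdivrMr // mulrDl divfK ?pnatr_eq0 //.
  by have := vC n; rewrite /v; lra.
rewrite ler0_norm ?subr_le0 // opprB ltrBlDr.
apply: (le_lt_trans hi); apply: (lt_le_trans (ltrD tm hn)).
by rewrite -addrA -splitr addrC.
Qed.

Lemma cvg_linear_growth (R : realType) (u : nat -> R) (P C : R) :
  (forall n, `|u n.+1 - n.+1%:R * P| <= C) ->
  (fun n => n.+1%:R^-1 * u n.+1) @ \oo --> P.
Proof.
move=> h.
have C0 : 0 <= C by apply: le_trans (h 0).
have n0 n : 0 < n.+1%:R :> R by rewrite ltr0n.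
have hC : C * @harmonic R n @[n --> \oo] --> 0.
  by rewrite -(mulr0 C); apply: cvgM; [exact: cvg_cst | exact: cvg_harmonic].
apply/cvgrPdist_lt => e e0.
apply: filterS (cvgr_lt _ hC _ e0) => n; apply: le_lt_trans.
have -> : P - n.+1%:R^-1 * u n.+1 = - (u n.+1 - n.+1%:R * P) * n.+1%:R^-1.
  by field; rewrite addrC natr1 pnatr_eq0.
by rewrite normrM normrN [X in _ * X]gtr0_norm ?invr_gt0 // ler_pM2r ?invr_gt0.
Qed.

(** The inequality ln t <= t - 1 at t = y / x. The last hypothesis rules out [y = 0 < x], where
    [ln y] would be a default value. *)
Lemma mul_ln_le (R : realType) (x y : R) : 0 <= x -> 0 <= y -> (y = 0 -> x = 0) ->
  x * ln y - x * ln x <= y - x.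
Proof.
move=> x0 y0 xy.
have [->|xn] := eqVneq x 0; first by rewrite !mul0r !subr0.
have {}x0 : 0 < x by rewrite lt_def xn.
have {}y0 : 0 < y by rewrite lt_def y0 andbT; apply: contra_neq xn.
rewrite -mulrBr -ln_div ?posrE //.
have -> : y - x = x * (y / x - 1) by field.
rewrite ler_pM2l // -[in ln _](subrK 1 (y / x)) addrC le_ln1Dx //.
by rewrite ltrBrDr addNr divr_gt0.
Qed.

(** * Entropy and the mean logarithm of a weight *)

Section Entropy.
Variables (R : realType) (k : nat).
Local Notation A := 'I_k.+1.
Variables (S : set (sq k)) (mu : {measure set (sqm k) -> \bar R}).
Hypotheses (hSc : word_closed S) (inv : invariant_prob S mu).

Let foo := invariant_prob_fin inv.

Definition block_entropy n : R := wsum n (fun w => - (wt mu w * ln (wt mu w))).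

Lemma wt_le1 w : wt mu w <= 1.
Proof.
rewrite -(wsum_wt1 inv (size w)); apply: ler_wsum1 => // v; exact: wt_ge0.
Qed.

Let wt_cat0l u v : wt mu u = 0 -> wt mu (u ++ v) = 0.
Proof.
move=> h; apply/eqP; rewrite eq_le wt_ge0 andbT -h (wt_catr (size v) u foo).
by apply: (@ler_wsum1 _ _ _ (fun v => wt mu (u ++ v))) => // w; exact: wt_ge0.
Qed.

Let wt_cat0r u v : wt mu v = 0 -> wt mu (u ++ v) = 0.
Proof.
move=> h; apply/eqP; rewrite eq_le wt_ge0 andbT -h (wt_catl inv (size u) v).
by apply: (@ler_wsum1 _ _ _ (fun u => wt mu (u ++ v))) => // w; exact: wt_ge0.
Qed.

Let wsum_catl n m (F : seq A -> R) :
  wsum n (fun u => wsum m (fun v => wt mu (u ++ v) * F u)) = wsum n (fun u => wt mu u * F u).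
Proof. by apply: eq_wsum => u _; rewrite wsumZr -wt_catr. Qed.

Let wsum_catr n m (F : seq A -> R) :
  wsum n (fun u => wsum m (fun v => wt mu (u ++ v) * F v)) = wsum m (fun u => wt mu u * F u).
Proof.
rewrite exchange_wsum; apply: eq_wsum => u _; rewrite wsumZr.
by rewrite (wt_catl inv n).
Qed.

(** Gibbs inequality between the law of the words [u ++ v] and the product of its marginals; the
    second marginal is again [wt mu] by shift invariance. *)
Lemma block_entropyD n m : block_entropy (n + m) <= block_entropy n + block_entropy m.
Proof.
have e j : block_entropy j = - wsum j (fun w => wt mu w * ln (wt mu w)).
  by rewrite -mulN1r -wsumZ; apply: eq_wsum => w _; rewrite mulN1r.
rewrite !e -opprD lerNl opprK -subr_le0 -(wsum_catl n m) -(wsum_catr n m).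
rewrite -wsumD wsum_cat -mulN1r -wsumZ -wsumD.
apply: (@le_trans _ _ (wsum n (fun u => wsum m (fun v => wt mu u * wt mu v + - 1 * wt mu (u ++ v))))).
  apply: ler_wsum => u _; rewrite -wsumD -wsumZ -wsumD; apply: ler_wsum => v _.
  rewrite -mulrDr !mulN1r; have [u0|u0] := eqVneq (wt mu u) 0.
    by rewrite wt_cat0l // !mul0r u0 mul0r.
  have [v0|v0] := eqVneq (wt mu v) 0.
    by rewrite wt_cat0r // !mul0r v0 mulr0.
  have gt0 w : wt mu w != 0 -> 0 < wt mu w by move=> h; rewrite lt_def h wt_ge0.
  rewrite -lnM ?posrE ?gt0 //; apply: mul_ln_le; rewrite ?mulr_ge0 ?wt_ge0 //.
  by move/eqP; rewrite mulf_eq0 (negbTE u0) (negbTE v0).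
have -> : wsum n (fun u => wsum m (fun v => wt mu u * wt mu v + - 1 * wt mu (u ++ v))) =
    wsum n (fun u => wt mu u + - 1 * wsum m (fun v => wt mu (u ++ v))).
  apply: eq_wsum => u _; rewrite wsumD !wsumZ.
  by rewrite (wsum_wt1 inv) mulr1.
by rewrite wsumD wsumZ -wsum_cat !(wsum_wt1 inv) mulr1 subrr.
Qed.

Lemma block_entropy_ge0 n : 0 <= block_entropy n.
Proof.
apply: wsum_ge0 => w _; rewrite -mulrN mulr_ge0 ?wt_ge0 // oppr_ge0.
by rewrite ln_le0 ?wt_le1.
Qed.

(** [entropy] is a [lim], which says something only once convergence is known; subadditivity
    provides it. *)
Lemma cvg_entropy : (fun n => n.+1%:R^-1 * block_entropy n.+1) @ \oo --> (entropy mu : R).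
Proof.
suff : cvg ((fun n => n.+1%:R^-1 * block_entropy n.+1) @ \oo) by [].
apply: (@fekete _ _ 0) => [n m _ _|n _]; first exact: block_entropyD.
by rewrite mulr0 oppr0 block_entropy_ge0.
Qed.

Variables (a : seq A -> R).
Hypotheses (hS : shift_closed S) (ga : gibbs_weight S a).

(** Stands in for the integral of [ln (f n x)]: when [f n] is comparable to e^(nP) [a], the two
    differ by nP up to a bounded error. *)
Definition mean_log n : R := wsum n (fun w => wt mu w * ln (a w)).

Let ln_gibbs_weightD : exists C : R, 0 <= C /\ forall u v, allowable S (u ++ v) ->
  `|ln (a (u ++ v)) - (ln (a u) + ln (a v))| <= C.
Proof.
have [a0 _ _ [c [c0 hc]]] := ga.
exists `|ln c|; split=> // u v auv.
have uv0 := a0 _ auv.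
have u0 := a0 _ (allowable_catl auv).
have v0 := a0 _ (allowable_catr hS auv).
have ci : 0 < c^-1 by rewrite invr_gt0.
have uv : 0 < a u * a v by rewrite mulr_gt0.
have /andP[] := hc _ _ auv.
rewrite -ler_ln ?posrE ?mulr_gt0 // => h1.
rewrite -ler_ln ?posrE ?mulr_gt0 // => h2.
move: h1 h2; rewrite !lnM ?posrE // lnV ?posrE //.
have := ler_norm (ln c); have := ler_norm (- ln c); rewrite normrN ler_norml.
by move=> ? ? ? ?; apply/andP; split; lra.
Qed.

(** The defect of additivity of [ln a] is bounded on allowable words [u ++ v], and the other words
    have measure zero. *)
Lemma mean_logD : exists C : R, 0 <= C /\ forall n m,
  `|mean_log (n + m) - (mean_log n + mean_log m)| <= C.
Proof.
have [C [C0 hC]] := ln_gibbs_weightD; exists C; split=> // n m.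
rewrite /mean_log -(wsum_catl n m) -(wsum_catr n m) -wsumD wsum_cat.
rewrite -mulN1r -wsumZ -wsumD.
pose d u v := ln (a (u ++ v)) - (ln (a u) + ln (a v)).
have -> : wsum n (fun u => wsum m (fun v => wt mu (u ++ v) * ln (a (u ++ v))) +
    -1 * (wsum m (fun v => wt mu (u ++ v) * ln (a u)) + wsum m (fun v => wt mu (u ++ v) * ln (a v)))) =
  wsum n (fun u => wsum m (fun v => wt mu (u ++ v) * d u v)).
  apply: eq_wsum => u _; rewrite -wsumD -wsumZ -wsumD; apply: eq_wsum => v _.
  by rewrite /d; ring.
have le1 : wsum n (fun u => wsum m (fun v => wt mu (u ++ v) * C)) = C.
  by rewrite wsum_catl wsumZr (wsum_wt1 inv) mul1r.
rewrite -le1 ler_norml; apply/andP; split.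
  rewrite -mulN1r -wsumZ; apply: ler_wsum => u _; rewrite -wsumZ; apply: ler_wsum => v _.
  have [/hC|/(wt_supp hSc inv)->] := pselect (allowable S (u ++ v)); last by rewrite !mul0r mulr0.
  by rewrite mulrCA ler_norml mulN1r => /andP[h _]; rewrite ler_wpM2l ?wt_ge0.
apply: ler_wsum => u _; apply: ler_wsum => v _.
have [/hC|/(wt_supp hSc inv)->] := pselect (allowable S (u ++ v)); last by rewrite !mul0r.
by rewrite ler_norml => /andP[_ h]; rewrite ler_wpM2l ?wt_ge0.
Qed.

Lemma cvg_mean_log : cvg ((fun n => n.+1%:R^-1 * mean_log n.+1) @ \oo).
Proof.
have [C [C0 hC]] := mean_logD.
have h1 : cvg ((fun n => n.+1%:R^-1 * (mean_log n.+1 + C)) @ \oo).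
  (* [mean_log n + C] is subadditive, and adding one letter at a time gives the linear lower bound
     with slope [mean_log 1 - C]. *)
  apply: (@fekete _ (fun n => mean_log n + C) (C - mean_log 1)) => [n m _ _|].
    by have := hC n m; rewrite ler_norml => /andP[_]; lra.
  elim=> // -[_ _|n IH _]; first by lra.
  have := IH isT; have := hC n.+1 1; rewrite addn1 ler_norml => /andP[+ _].
  rewrite -[n.+2%:R]natr1; lra.
have hc : C * @harmonic R n @[n --> \oo] --> C * 0.
  by apply: cvgM; [exact: cvg_cst | exact: cvg_harmonic].
have -> : (fun n => n.+1%:R^-1 * mean_log n.+1) =
    (fun n => n.+1%:R^-1 * (mean_log n.+1 + C) - C * @harmonic R n).
  by apply/funext => n; rewrite /harmonic /=; ring.
exact: is_cvgB h1 (cvgP _ hc).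
Qed.

(** Gibbs inequality between [wt mu] and [a], both of total mass one on words of length [n]. *)
Lemma block_entropy_mean_log_le0 n : block_entropy n + mean_log n <= 0.
Proof.
have [_ aN a1 _] := ga.
rewrite -wsumD; apply: (@le_trans _ _ (wsum n (fun w => a w + - 1 * wt mu w))); last first.
  by rewrite wsumD wsumZ a1 (wsum_wt1 inv) mulr1 subrr.
apply: ler_wsum => w _; rewrite addrC mulN1r.
apply: mul_ln_le; rewrite ?wt_ge0 //; first exact: gibbs_weight_ge0 ga.
move=> aw; apply: (wt_supp hSc inv) => /(let: And4 h _ _ _ := ga in h w).
by rewrite aw ltxx.
Qed.

Lemma block_entropy_mean_log_ge (K : R) n : 0 < K ->
  (forall w, wt mu w <= K * a w) -> - ln K <= block_entropy n + mean_log n.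
Proof.
move=> K0 h; rewrite -wsumD.
apply: (@le_trans _ _ (wsum n (fun w => wt mu w * (- ln K)))).
  by rewrite wsumZr (wsum_wt1 inv) mul1r.
apply: ler_wsum => w _; have := wt_ge0 mu w; rewrite le_eqVlt => /orP[/eqP<-|w0].
  by rewrite !mul0r oppr0 addr0.
have a0 : 0 < a w by have := lt_le_trans w0 (h w); rewrite pmulr_rgt0.
rewrite addrC -mulrBr ler_pM2l //.
by have := h w; rewrite -ler_ln ?posrE ?mulr_gt0 // lnM ?posrE //; lra.
Qed.

End Entropy.

(** Within [S] a superlevel set is the countable union of the cylinders on which [h] stays above the
    level. *)
Lemma measurable_cyl_continuous (R : realType) (k : nat) (S : set (sq k)) (h : sq k -> R) :
  word_closed S ->
  (forall x e, S x -> 0 < e -> exists N, forall x', S x' ->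
      word x N = word x' N -> `|h x - h x'| < e) ->
  measurable_fun (S : set (sqm k)) (h : sqm k -> R).
Proof.
move=> hSc hh mS; apply: (measurability _ (RGenOInfty.measurableE R)) => //.
move=> /= _ [_ [r ->] <-].
have -> : S `&` h @^-1` `]r, +oo[%classic = S `&` \bigcup_n
    \big[setU/set0]_(w : n.-tuple 'I_k.+1 | `[< forall x', S x' -> cyl w x' -> r < h x' >]) cyl w.
  apply/seteqP; split=> x [Sx]; rewrite /= ?in_itv /= ?andbT.
    move=> rx; split=> //.
    have [N hN] := hh x (h x - r) Sx (ltac:(by rewrite subr_gt0)).
    exists N => //; rewrite -bigcup_seq_cond; exists [tuple of word x N]; last exact: cyl_word.
    rewrite /= mem_index_enum; apply/asboolP => x' Sx' /(cylP _ (size_word x N)) xx'.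
    by have := hN x' Sx' (esym xx'); rewrite ltr_norml => /andP[_]; lra.
  move=> [n _]; rewrite -bigcup_seq_cond => -[w /= /andP[_ /asboolP hw] xw].
  by split=> //=; rewrite ?in_itv /= ?andbT; exact: hw.
apply: measurableI; first exact: measurable_cyl_closed.
apply: bigcupT_measurable => n; apply: bigsetU_measurable => w _.
exact: measurable_cyl.
Qed.

Section CylinderIntegral.
Variables (R : realType) (k : nat).
Local Notation A := 'I_k.+1.
Variables (S : set (sq k)) (mu : {measure set (sqm k) -> \bar R}).
Hypotheses (hSc : word_closed S) (inv : invariant_prob S mu).

Let foo := invariant_prob_fin inv.
Let mS : measurable (S : set (sqm k)) := measurable_cyl_closed hSc.

Let wt_in w : fine (mu (S `&` cyl w)) = wt mu w.
Proof.
have mw := @measurable_cyl k w.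
have m1 : fine (mu S) = 1 by case: inv => _ -> _.
have := fine_le_measure foo (measurableD mw mS) (measurableC mS) (@subDsetr _ _ _).
have : fine (mu (~` S)) = 0.
  have := fineDI foo (@measurableT _ (sqm k)) mS; rewrite setTI setTD m1.
  have -> : fine (mu setT) = 1 by case: inv => ->.
  lra.
have := fineDI foo mw mS; rewrite setIC /wt => -> ->.
have : 0 <= fine (mu (cyl w `\` S)) by rewrite fine_ge0.
lra.
Qed.

Lemma integral_cyl_bounds (h : sq k -> R) (lo hi : seq A -> R) n :
  measurable_fun (S : set (sqm k)) (h : sqm k -> R) ->
  (forall x, S x -> lo (word x n) <= h x <= hi (word x n)) ->
  wsum n (fun w => wt mu w * lo w) <=
    fine (\int[mu]_(x in (S : set (sqm k))) (h x)%:E) <=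
  wsum n (fun w => wt mu w * hi w).
Proof.
move=> mh hb.
pose F (w : n.-tuple A) : set (sqm k) := S `&` cyl w.
have mF w : measurable (F w) by apply: measurableI => //; exact: measurable_cyl.
have Fin w : (mu (F w) < +oo)%E by rewrite -ge0_fin_numE // finite_measure_num.
have mhF w : measurable_fun (F w) (h : sqm k -> R).
  by apply: measurable_funS mh => // x [].
have hF (w : n.-tuple A) x : F w x -> lo w <= h x <= hi w.
  by move=> [Sx /(cylP _ (size_tuple w)) <-]; exact: hb.
have ih w : mu.-integrable (F w) (EFin \o h).
  apply: measurable_bounded_integrable => //.
  exists (`|lo w| + `|hi w|); split => // r hr x /hF.
  have := ler_norm (- lo w); have := ler_norm (hi w); rewrite normrN.
  move=> ? ? /andP[? ?] /=; have := normr_ge0 (lo w); have := normr_ge0 (hi w).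
  by move=> ? ?; rewrite ler_norml; apply/andP; split; lra.
have ic w c : mu.-integrable (F w) (EFin \o cst c).
  apply: measurable_bounded_integrable => //.
  by exists `|c|; split => // r hr x _ /=; exact: ltW.
have hlo (w : n.-tuple A) : wt mu w * lo w <= \int[mu]_(x in F w) h x.
  rewrite -wt_in mulrC -(Rintegral_cst mu (mF w)).
  by apply: (le_Rintegral (mF w) (ic w _) (ih w)) => x /hF /andP[].
have hhi (w : n.-tuple A) : \int[mu]_(x in F w) h x <= wt mu w * hi w.
  rewrite -wt_in mulrC -(Rintegral_cst mu (mF w)).
  by apply: (le_Rintegral (mF w) (ih w) (ic w _)) => x /hF /andP[].
have -> : fine (\int[mu]_(x in (S : set (sqm k))) (h x)%:E) =
    \sum_(w : n.-tuple A) \int[mu]_(x in F w) h x.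
  rewrite {1}(cyl_split S n) integral_bigsetU_EFin //.
  - by rewrite -sum_fine // => w _; exact: integrable_fin_num (ih w).
  - exact: index_enum_uniq.
  - by move=> u v _ _ [x [[_ ux] [_ vx]]]; exact: eq_cyl ux vx.
  - by rewrite -(cyl_split S n); exact/measurable_EFinP.
by apply/andP; split; apply: ler_sum.
Qed.

End CylinderIntegral.

(** * Free energy of potentials comparable to a Gibbs weight *)

Section VariationalPrinciple.
Variables (R : realType) (k : nat).
Local Notation A := 'I_k.+1.
Variables (S : set (sq k)) (a : seq A -> R) (f : nat -> sq k -> R) (P C : R).
Hypotheses (hS : shift_closed S) (hSc : word_closed S).
Hypotheses (ga : gibbs_weight S a) (pf : potential S f) (C0 : 0 < C).
(** The growth rate [P] is a parameter: on [X] it is instantiated with [pressure Y f], and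
    [pressureE] then identifies it with the pressure of the lifted potential. *)
Hypothesis hfa : forall x n, S x -> (0 < n)%N ->
  C^-1 * (expR (n%:R * P) * a (word x n)) <= f n x <=
  C * (expR (n%:R * P) * a (word x n)).

Let a1 n : wsum n a = 1. Proof. by case: ga. Qed.

Let Zpart_bounds n : (0 < n)%N ->
  C^-1 * expR (n%:R * P) <= Zpart S f n <= C * expR (n%:R * P).
Proof.
move=> n0.
have aN w : ~ allowable S w -> a w = 0 by case: ga => _ + _ _; exact.
have -> : Zpart S f n = wsum n (fun w =>
    if `[< allowable S w >] then sup [set f n x | x in S `&` cyl w] else 0).
  by rewrite /Zpart big_mkcond.
have hb (w : seq A) : size w = n -> allowable S w ->
    C^-1 * (expR (n%:R * P) * a w) <= sup [set f n x | x in S `&` cyl w] <=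
    C * (expR (n%:R * P) * a w).
  move=> sw [x Sx xw].
  have ub : ubound [set f n x | x in S `&` cyl w] (C * (expR (n%:R * P) * a w)).
    move=> _ [y [Sy /(cylP _ sw) yw] <-]; rewrite -yw.
    by have /andP[] := hfa Sy n0.
  apply/andP; split; last by apply: ge_sup => //; exists (f n x), x.
  apply: (@le_trans _ _ (f n x)); last by apply: ub_le_sup; [exists (C * (expR (n%:R * P) * a w)) | exists x].
  by move/(cylP _ sw) in xw; rewrite -xw; have /andP[] := hfa Sx n0.
apply/andP; split.
  rewrite [leLHS](_ : _ = wsum n (fun w => C^-1 * expR (n%:R * P) * a w)); last first.
    by rewrite wsumZ a1 mulr1.
  apply: ler_wsum => w sw.
  case: asboolP => [/(hb w sw)/andP[h _]|/aN->]; last by rewrite mulr0.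
  by rewrite -mulrA.
rewrite [leRHS](_ : _ = wsum n (fun w => C * expR (n%:R * P) * a w)); last first.
  by rewrite wsumZ a1 mulr1.
apply: ler_wsum => w sw.
case: asboolP => [/(hb w sw)/andP[_ h]|/aN->]; last by rewrite mulr0.
by rewrite -mulrA.
Qed.

Let ln_bounds (x y z : R) : 0 < x ->
  C^-1 * (expR z * x) <= y <= C * (expR z * x) -> `|ln y - z - ln x| <= `|ln C|.
Proof.
move=> x0 /andP[h1 h2].
have ci : 0 < C^-1 by rewrite invr_gt0.
have e0 := expR_gt0 z.
have y0 : 0 < y by apply: lt_le_trans h1; rewrite !mulr_gt0.
move: h1 h2; rewrite -ler_ln ?posrE ?mulr_gt0 // => h1.
rewrite -ler_ln ?posrE ?mulr_gt0 // => h2.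
move: h1 h2; rewrite !lnM ?posrE ?mulr_gt0 // lnV ?posrE // expRK.
have := ler_norm (ln C); have := ler_norm (- ln C); rewrite normrN ler_norml.
by move=> ? ? ? ?; apply/andP; split; lra.
Qed.

Lemma pressureE : pressure S f = P.
Proof.
apply/cvg_lim => //; apply: (@cvg_linear_growth _ (fun n => ln (Zpart S f n)) _ `|ln C|) => n.
have := @ln_bounds 1 (Zpart S f n.+1) (n.+1%:R * P) ltr01.
by rewrite mulr1 ln1 subr0; apply; exact: Zpart_bounds.
Qed.

Section Invariant.
Variable mu : {measure set (sqm k) -> \bar R}.
Hypothesis inv : invariant_prob S mu.

Let int_ln n : R := fine (\int[mu]_(x in (S : set (sqm k))) (ln (f n x))%:E).

Let int_ln_mean n : (0 < n)%N -> `|int_ln n - n%:R * P - mean_log mu a n| <= `|ln C|.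
Proof.
move=> n0.
have mh : measurable_fun (S : set (sqm k)) (fun x : sqm k => ln (f n x)).
  apply: (measurableT_comp (@measurable_ln R)).
  by apply: measurable_cyl_continuous => // x e; have [_] := pf n0; exact.
have hb x : S x -> n%:R * P + ln (a (word x n)) + - `|ln C| <= ln (f n x) <=
    n%:R * P + ln (a (word x n)) + `|ln C|.
  move=> Sx; have ax : 0 < a (word x n) by case: ga => + _ _ _; apply; exact: allowable_word.
  have := ln_bounds ax (hfa Sx n0); rewrite ler_norml => /andP[? ?].
  by apply/andP; split; lra.
have := @integral_cyl_bounds R k S mu hSc inv (fun x => ln (f n x))
  (fun w => n%:R * P + ln (a w) + - `|ln C|) (fun w => n%:R * P + ln (a w) + `|ln C|) n mh hb.
have e c : wsum n (fun w => wt mu w * (n%:R * P + ln (a w) + c)) =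
    n%:R * P + mean_log mu a n + c.
  transitivity (wsum n (fun w => wt mu w * (n%:R * P + c) + wt mu w * ln (a w))).
    by apply: eq_wsum => w _; ring.
  by rewrite wsumD wsumZr (wsum_wt1 inv) mul1r /mean_log addrAC.
rewrite !e -/(int_ln n) => /andP[? ?].
by rewrite ler_norml; apply/andP; split; lra.
Qed.

(** The integral of [ln (f n x)] stays within a bounded distance of nP + [mean_log], so the averages
    differ by [P] in the limit and inherit convergence from [mean_log]. *)
Lemma cvg_lyap : (fun n => n.+1%:R^-1 * mean_log mu a n.+1) @ \oo --> lyap S f mu - P.
Proof.
have h1 := cvg_mean_log hSc inv hS ga.
have h2 : (fun n => n.+1%:R^-1 * (int_ln n.+1 - mean_log mu a n.+1)) @ \oo --> P.
  apply: (@cvg_linear_growth _ (fun n => int_ln n - mean_log mu a n) _ `|ln C|) => n.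
  by have := @int_ln_mean n.+1 isT; rewrite addrAC.
have h3 : (fun n => n.+1%:R^-1 * int_ln n.+1) @ \oo -->
    P + lim ((fun n => n.+1%:R^-1 * mean_log mu a n.+1) @ \oo).
  have -> : (fun n => n.+1%:R^-1 * int_ln n.+1) = (fun n =>
      n.+1%:R^-1 * (int_ln n.+1 - mean_log mu a n.+1) + n.+1%:R^-1 * mean_log mu a n.+1).
    by apply/funext => n; rewrite -mulrDr subrK.
  exact: cvgD h2 h1.
have -> : lyap S f mu = P + lim ((fun n => n.+1%:R^-1 * mean_log mu a n.+1) @ \oo).
  exact: cvg_lim h3.
by rewrite addrC addKr.
Qed.

Let cvg_free : (fun n => n.+1%:R^-1 * (block_entropy mu n.+1 + mean_log mu a n.+1)) @ \oo -->
  entropy mu + (lyap S f mu - P).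
Proof.
have -> : (fun n => n.+1%:R^-1 * (block_entropy mu n.+1 + mean_log mu a n.+1)) =
    (fun n => n.+1%:R^-1 * block_entropy mu n.+1 + n.+1%:R^-1 * mean_log mu a n.+1).
  by apply/funext => n; rewrite mulrDr.
exact: cvgD (cvg_entropy inv) cvg_lyap.
Qed.

Lemma free_energy_le : entropy mu + lyap S f mu <= P.
Proof.
rewrite -subr_le0 -addrA; apply: (cvgr_to_le cvg_free); apply: nearW => n.
by rewrite pmulr_rle0 ?invr_gt0 ?ltr0n // (block_entropy_mean_log_le0 hSc inv ga).
Qed.

Lemma free_energy_gibbs (K : R) : 0 < K -> (forall w, wt mu w <= K * a w) ->
  entropy mu + lyap S f mu = P.
Proof.
move=> K0 hK; apply/eqP; rewrite -subr_eq0 -addrA; apply/eqP.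
have h : (fun n => n.+1%:R^-1 * (block_entropy mu n.+1 + mean_log mu a n.+1)) @ \oo --> (0 : R).
  apply: (@cvg_linear_growth _ (fun n => block_entropy mu n + mean_log mu a n) _ `|ln K|) => n.
  rewrite mulr0 subr0.
  have := block_entropy_mean_log_le0 hSc inv ga n.+1.
  have := block_entropy_mean_log_ge inv n.+1 K0 hK.
  by have := ler_norm (ln K); rewrite ler_norml => ? ? ?; apply/andP; split; lra.
exact: cvg_unique cvg_free h.
Qed.

End Invariant.

(** The measure [mu] makes the set of free energies nonempty and attains the bound [P]. *)
Lemma var_pressureE (mu : {measure set (sqm k) -> \bar R}) (K : R) :
  invariant_prob S mu -> 0 < K -> (forall w, wt mu w <= K * a w) ->
  var_pressure S f = P.
Proof.
move=> inv K0 hK.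
have ub : ubound [set entropy mu + lyap S f mu | mu in [set mu | invariant_prob S mu]] P.
  by move=> _ [m minv <-]; exact: free_energy_le.
apply/eqP; rewrite eq_le; apply/andP; split.
  by apply: ge_sup => //; exists (entropy mu + lyap S f mu), mu.
rewrite -{1}(free_energy_gibbs inv K0 hK); apply: ub_le_sup; first by exists P.
by exists mu.
Qed.

End VariationalPrinciple.
(** * Lifting along the factor map *)

Section GibbsComparison.
Variables (R : realType) (k : nat).
Local Notation A := 'I_k.+1.
Variables (S : set (sq k)) (a : seq A -> R) (f : nat -> sq k -> R) (C : R).
Variable mu : {measure set (sqm k) -> \bar R}.
Hypotheses (inv : invariant_prob S mu) (ga : gibbs_weight S a) (C0 : 0 < C).
Hypotheses (hS : shift_closed S) (hSc : word_closed S).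
Hypothesis hfa : forall x n, S x -> (0 < n)%N ->
  C^-1 * (expR (n%:R * pressure S f) * a (word x n)) <= f n x <=
  C * (expR (n%:R * pressure S f) * a (word x n)).

Let foo := invariant_prob_fin inv.
Let P := pressure S f.

Lemma gibbs_of_weight (K : R) : 0 < K ->
  (forall w, wt mu w <= K * a w) -> (forall w, a w <= K * wt mu w) -> gibbs S f mu.
Proof.
(* The factor 2 makes the weak bounds strict, as [gibbs] requires. *)
move=> K0 h1 h2; exists (2 * (K * C)); split; first by rewrite !mulr_gt0.
move=> x n Sx n0; rewrite -(wtE _ foo) !lte_fin.
have a0 : 0 < a (word x n) by case: ga => + _ _ _; apply; exact: allowable_word.
have /andP[] := hfa Sx n0; rewrite -/P mulNr expRN.
set e := expR _; have e0 : 0 < e := expR_gt0 _.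
set b := a _ in a0 *; have {}h1 := h1 (word x n); have {}h2 := h2 (word x n).
rewrite -/b in h1 h2; set m := wt _ _ in h1 h2 * => f1 f2.
have m0 : 0 < m by have := lt_le_trans a0 h2; rewrite pmulr_rgt0.
have KC : 0 < K * C by rewrite mulr_gt0.
apply/andP; split.
  rewrite mulrC ltr_pdivrMr ?mulr_gt0 // mulrC ltr_pdivrMr //.
  apply: (le_lt_trans f2).
  have h : C * (e * b) <= C * (e * (K * m)) by rewrite !ler_pM2l.
  apply: (le_lt_trans h).
  have -> : m * (2 * (K * C)) * e = C * (e * (K * m)) + C * (e * (K * m)) by ring.
  by rewrite ltrDl !mulr_gt0.
apply: (le_lt_trans h1).
have f3 : C^-1 * b <= e^-1 * f n x.
  rewrite [leRHS]mulrC ler_pdivlMr //; apply: le_trans f1.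
  by rewrite -mulrA [b * e]mulrC.
apply: (@lt_le_trans _ _ (2 * (K * C) * (C^-1 * b))); last by rewrite ler_pM2l // !mulr_gt0.
have -> : 2 * (K * C) * (C^-1 * b) = K * b + K * b by field; rewrite gt_eqF.
by rewrite ltrDl mulr_gt0.
Qed.

Lemma weight_of_gibbs : gibbs S f mu -> exists K : R, [/\ 0 < K,
  (forall w, wt mu w <= K * a w) & (forall w, a w <= K * wt mu w)].
Proof.
case=> C1 [C10 hC1].
have K0 : 0 < C1 * C by rewrite mulr_gt0.
have [a0 aN a1 _] := ga.
have nil1 : wt mu [::] = a [::].
  by have := a1 0; have := wsum_wt1 inv 0; rewrite !wsum0 => -> ->.
have key x n : S x -> (0 < n)%N ->
    wt mu (word x n) <= C1 * C * a (word x n) /\ a (word x n) <= C1 * C * wt mu (word x n).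
  move=> Sx n0; have := hC1 x n Sx n0; rewrite -(wtE _ foo) !lte_fin -/P mulNr expRN.
  have /andP[] := hfa Sx n0; rewrite -/P.
  set e := expR _; have e0 : 0 < e := expR_gt0 _.
  set b := a _; set m := wt _ _ => f1 f2 /andP[g1 g2]; split.
    apply: (le_trans (ltW g2)); rewrite -mulrA ler_pM2l //.
    by rewrite mulrC ler_pdivrMr // -mulrA [b * e]mulrC.
  have h : C^-1 * b <= C1 * m.
    have : e^-1 * f n x <= C1 * m.
      by move: g1; rewrite mulrC ltr_pdivrMr // mulrC [m * _]mulrC => /ltW.
    apply: le_trans; rewrite [leRHS]mulrC ler_pdivlMr //; apply: le_trans f1.
    by rewrite -mulrA [b * e]mulrC.
  by move: h; rewrite mulrC ler_pdivrMr // mulrAC.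
(* [gibbs] speaks of positive lengths; the summand 1 takes care of the empty word, on which both
   weights agree. *)
exists (C1 * C + 1); split; first by rewrite addr_gt0.
- move=> w; have [[x Sx xw]|aw] := pselect (allowable S w); last first.
    by rewrite (wt_supp hSc inv aw) aN // mulr0.
  have [w0|w0] := posnP (size w).
    rewrite (size0nil w0) nil1 mulrDl mul1r lerDr.
    by apply: mulr_ge0; [exact: ltW | rewrite -nil1 wt_ge0].
  have [+ _] := key x (size w) Sx w0; rewrite (xw : word x (size w) = w) => /le_trans; apply.
  by rewrite mulrDl lerDl mul1r (gibbs_weight_ge0 w ga).
- move=> w; have [[x Sx xw]|aw] := pselect (allowable S w); last first.
    by rewrite (wt_supp hSc inv aw) aN // mulr0.
  have [w0|w0] := posnP (size w).
    rewrite (size0nil w0) nil1 mulrDl mul1r lerDr.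
    by apply: mulr_ge0; [exact: ltW | rewrite -nil1 wt_ge0].
  have [_] := key x (size w) Sx w0; rewrite (xw : word x (size w) = w) => /le_trans; apply.
  by rewrite mulrDl lerDl mul1r wt_ge0.
Qed.

End GibbsComparison.

(** * Fibers of the factor map on words *)

Section Fibers.
Variables (R : realType) (k l : nat) (p : 'I_k.+1 -> 'I_l.+1).
Variables (X : set (sq k)) (Y : set (sq l)).
Hypotheses (hX : shift_closed X) (XY : blockmap p @` X = Y).

Lemma allowable_map w : allowable X w -> allowable Y (map p w).
Proof.
case=> x Xx xw; exists (blockmap p x); first by rewrite -XY; exists x.
by rewrite /cyl /= size_map blockmap_word (xw : word x (size w) = w).
Qed.

Lemma allowable_lift y : allowable Y y -> exists w, allowable X w /\ map p w = y.
Proof.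
case=> z; rewrite -XY => -[x Xx <-] xy; exists (word x (size y)).
by split; [exact: allowable_word | rewrite -blockmap_word].
Qed.

(** Words of [Y] are lifted, connected in [X] and projected; the gap length is unchanged. *)
Lemma specification_factor : specification X -> specification Y.
Proof.
move=> [q [q0 spec]]; exists q; split=> // u v u0 v0 /allowable_lift[u' [au uE]]
  /allowable_lift[v' [av vE]].
have [||w [sw aw]] := spec u' v' _ _ au av.
- by rewrite -(size_map p) uE.
- by rewrite -(size_map p) vE.
exists (map p w); split; first by rewrite size_map.
by rewrite -uE -vE -!map_cat; exact: allowable_map.
Qed.

Lemma wsum_pred1 n (z : seq 'I_l.+1) (c : R) : size z = n ->
  wsum n (fun y => (z == y)%:R * c) = c.
Proof.
move=> zn; rewrite wsumZr /wsum (bigD1 (tcast zn (in_tuple z))) //= big1 ?addr0.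
  by rewrite (_ : (z == _) = true) ?mul1r //; apply/eqP; case: _ / zn.
move=> y yz; rewrite (_ : (z == y) = false) //; apply/negbTE.
apply: contra yz => /eqP zy; apply/eqP/val_inj; rewrite /= -zy.
by case: _ / zn.
Qed.

Lemma wsum_fiber n (F : seq 'I_k.+1 -> R) :
  wsum n F = wsum n (fun y : seq 'I_l.+1 => wsum n (fun w => (map p w == y)%:R * F w)).
Proof.
rewrite exchange_wsum; apply: eq_wsum => w sw.
by rewrite wsum_pred1 // size_map.
Qed.

Lemma npreE y : (npre X p y)%:R =
  wsum (size y) (fun w => (`[< allowable X w >] && (map p w == y))%:R : R).
Proof.
rewrite /npre -sum1_card natr_sum big_mkcond /=; apply: eq_bigr => w _.
rewrite (_ : (w \in _) = `[< allowable X w >] && (map p w == y)); first by case: (_ && _).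
by apply/idP/idP => [/set_mem|?]; last exact: mem_set.
Qed.

Lemma npre_gt0 y : allowable Y y -> (0 < npre X p y)%N.
Proof.
move=> /allowable_lift[w [aw wy]]; rewrite /npre lt0n.
have sw : size w = size y by rewrite -wy size_map.
apply/pred0Pn; exists (tcast sw (in_tuple w)); apply: mem_set => /=.
have -> : tval (tcast sw (in_tuple w)) = w by case: _ / sw.
by rewrite wy eqxx andbT; apply/asboolP.
Qed.

(** An allowable word over [y ++ z] is determined by its two pieces, which are allowable words over
    [y] and over [z]. *)
Lemma npre_cat y z : (npre X p (y ++ z) <= npre X p y * npre X p z)%N.
Proof.
rewrite -(ler_nat R) natrM !npreE size_cat wsum_cat -wsumZr.
apply: ler_wsum => u su; rewrite -wsumZ; apply: ler_wsum => v sv.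
rewrite map_cat eqseq_cat ?size_map // -natrM mulnb ler_nat.
case: asboolP => //= auv; case: eqP => //= _; case: eqP => //= _.
rewrite !andbT; case: asboolP => [_|/(_ (allowable_catl auv))//].
by case: asboolP => [//|/(_ (allowable_catr hX auv))].
Qed.

Lemma npre_conditionA : conditionA R X Y p ->
  exists D : R, 0 < D <= 1 /\ forall y z, allowable Y (y ++ z) ->
    D * (npre X p y)%:R * (npre X p z)%:R <= (npre X p (y ++ z))%:R.
Proof.
move=> [D [D01 hD]]; exists D; split=> // y z ayz.
have := hD (size y) (size z) (y ++ z) (size_cat _ _) ayz.
by rewrite take_size_cat // drop_size_cat.
Qed.

End Fibers.
(** Here [x], [y], [m] stand for the weights of [u], [v], [u ++ v], and [F1], [F2], [F] for the
    values of the potential. Each of the three comparisons costs a factor [C], and almost additivity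
    costs [E]. *)
Lemma quasi_bernoulli_transfer (R : realType) (C E e1 e2 x y m F1 F2 F : R) :
  0 < C -> 0 < E -> 0 < e1 -> 0 < e2 -> 0 < x -> 0 < y -> 0 < F1 -> 0 < F2 ->
  C^-1 * (e1 * x) <= F1 -> F1 <= C * (e1 * x) ->
  C^-1 * (e2 * y) <= F2 -> F2 <= C * (e2 * y) ->
  C^-1 * (e1 * e2 * m) <= F -> F <= C * (e1 * e2 * m) ->
  E^-1 * F1 * F2 <= F -> F <= E * F1 * F2 ->
  (C * C * C * E)^-1 * (x * y) <= m <= C * C * C * E * (x * y).
Proof.
move=> C0 E0 e10 e20 x0 y0 F10 F20 a1 a2 b1 b2 c1 c2 d1 d2.
have inv_le (c s t : R) : 0 < c -> c^-1 * s <= t -> s <= c * t.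
  by move=> c0; rewrite mulrC ler_pdivrMr // mulrC.
have {}a1 := inv_le _ _ _ C0 a1; have {}b1 := inv_le _ _ _ C0 b1.
have {}c1 := inv_le _ _ _ C0 c1.
have {}d1 : F1 * F2 <= E * F by apply: inv_le => //; rewrite mulrA.
have e0 : 0 < e1 * e2 by rewrite mulr_gt0.
have K0 : 0 < C * C * C * E by rewrite !mulr_gt0.
apply/andP; split.
  rewrite mulrC ler_pdivrMr // -(ler_pM2l e0).
  apply: (@le_trans _ _ ((C * F1) * (C * F2))).
    rewrite (_ : e1 * e2 * (x * y) = (e1 * x) * (e2 * y)); last by ring.
    by apply: ler_pM => //; rewrite ltW // mulr_gt0.
  apply: (@le_trans _ _ (C * C * (E * F))).
    rewrite (_ : C * F1 * (C * F2) = C * C * (F1 * F2)); last by ring.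
    by rewrite ler_pM2l // mulr_gt0.
  rewrite (_ : _ * (m * _) = C * C * (E * (C * (e1 * e2 * m)))); last by ring.
  by rewrite ler_pM2l ?mulr_gt0 // ler_pM2l.
rewrite -(ler_pM2l e0); apply: (le_trans c1).
rewrite (_ : _ * (_ * (x * y)) = C * (E * ((C * (e1 * x)) * (C * (e2 * y))))); last by ring.
rewrite ler_pM2l //; apply: (le_trans d2).
by rewrite -mulrA ler_pM2l //; apply: ler_pM => //; exact: ltW.
Qed.

(** * Cylinder weights of a Gibbs measure *)

Section MeasureWeight.
Variables (R : realType) (l : nat) (Y : set (sq l)) (f : nat -> sq l -> R).
Variable nu : {measure set (sqm l) -> \bar R}.
Hypotheses (hY : shift_closed Y) (hYc : word_closed Y).
Hypotheses (pf : potential Y f) (inv : invariant_prob Y nu) (gnu : gibbs Y f nu).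

Let foo := invariant_prob_fin inv.
Let P := pressure Y f.

Lemma gibbs_wt_bounds : exists C : R, 0 < C /\ forall y n, Y y -> (0 < n)%N ->
  C^-1 * (expR (n%:R * P) * wt nu (word y n)) <= f n y <=
  C * (expR (n%:R * P) * wt nu (word y n)).
Proof.
have [C [C0 hC]] := gnu; exists C; split=> // y n Yy n0.
have := hC y n Yy n0; rewrite -(wtE _ foo) !lte_fin -/P mulNr expRN.
set e := expR _; have e0 : 0 < e := expR_gt0 _; set m := wt _ _ => /andP[/ltW g1 /ltW g2].
apply/andP; split.
  rewrite mulrC ler_pdivrMr // [leRHS]mulrC.
  have -> : C * f n y = e * (C * (e^-1 * f n y)) by field; rewrite gt_eqF.
  by rewrite ler_pM2l.
have -> : f n y = C * (e * (C^-1 * (e^-1 * f n y))) by field; rewrite !gt_eqF.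
by rewrite ler_pM2l // ler_pM2l.
Qed.

(** Almost additivity of [f] passes to the cylinder weights, because the factors e^(nP) multiply
    exactly. *)
Lemma gibbs_weight_wt : almost_additive Y f -> gibbs_weight Y (wt nu).
Proof.
move=> [Ca [_ hCa]].
have [C1 [C10 hC1]] := gibbs_wt_bounds.
have nil1 : wt nu [::] = 1 by have := wsum_wt1 inv 0; rewrite wsum0.
have pos y n : Y y -> 0 < wt nu (word y n).
  case: n => [|n] Yy.
    by rewrite (_ : word y 0 = [::]) // nil1.
  have [f0 _] := pf (ltn0Sn n); have := f0 y Yy.
  have /andP[_ h] := hC1 y n.+1 Yy isT => /lt_le_trans/(_ h).
  by rewrite !pmulr_rgt0 ?expR_gt0.
split.
- by move=> w [y Yy yw]; rewrite -(yw : word y (size w) = w); exact: pos.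
- by move=> w; exact: wt_supp.
- by move=> n; exact: (wsum_wt1 inv n).
(* The summand 1 gives [K >= 1], which settles the cases where [u] or [v] is empty. *)
pose K := C1 * C1 * C1 * expR Ca + 1.
have eC : 0 < expR Ca := expR_gt0 _.
have CC : 0 < C1 * C1 * C1 * expR Ca by rewrite !mulr_gt0.
have K0 : 0 < K by rewrite addr_gt0.
have K1 : K^-1 <= 1 by rewrite invf_le1 // /K lerDr ltW.
have K1' : 1 <= K by rewrite /K lerDr ltW.
exists K^-1; split; first by rewrite invr_gt0.
move=> u v [y Yy /cyl_cat[yu yv]]; rewrite invrK.
have [u0|u0] := posnP (size u).
  by rewrite (size0nil u0) nil1 mul1r /= ler_piMl ?wt_ge0 //= ler_peMl ?wt_ge0.
have [v0|v0] := posnP (size v).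
  by rewrite (size0nil v0) nil1 mulr1 cats0 ler_piMl ?wt_ge0 //= ler_peMl ?wt_ge0.
set z := iter (size u) (@shift l) y in yv.
have Yz : Y z by exact: shift_closed_iter.
have wuv : word y (size u + size v) = u ++ v.
  by rewrite word_cat (yu : word y (size u) = u) (yv : word z (size v) = v).
have /andP[a1 a2] := hC1 y _ Yy u0; have /andP[b1 b2] := hC1 z _ Yz v0.
have uv0 : (0 < size u + size v)%N by rewrite addn_gt0 u0.
have /andP[c1 c2] := hC1 y _ Yy uv0.
have [d1 d2] := hCa (size u) (size v) y u0 v0 Yy.
have mu0 := pos y (size u) Yy; have mv0 := pos z (size v) Yz.
have F0 n x : (0 < n)%N -> Y x -> 0 < f n x by move=> n0 Yx; have [h _] := pf n0; exact: h.
move: a1 a2 b1 b2 c1 c2 d1 d2 mu0 mv0; rewrite wuv natrD mulrDl expRD expRN.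
rewrite (yu : word y (size u) = u) (yv : word z (size v) = v) -/z.
move=> a1 a2 b1 b2 c1 c2 d1 d2 mu0 mv0.
have /andP[h1 h2] := quasi_bernoulli_transfer C10 eC (expR_gt0 _) (expR_gt0 _) mu0 mv0
  (F0 _ _ u0 Yy) (F0 _ _ v0 Yz) a1 a2 b1 b2 c1 c2 d1 d2.
have uvge0 : 0 < wt nu u * wt nu v by rewrite mulr_gt0.
have KC : C1 * C1 * C1 * expR Ca <= K by rewrite /K lerDl.
apply/andP; split.
  apply: le_trans h1; rewrite ler_pM2r // lef_pV2 //.
by apply: (le_trans h2); rewrite ler_pM2r.
Qed.

End MeasureWeight.

(** Applied both to weights and to potentials, with fiber counts as denominators: [Z <= X * Y] gives
    the lower bound and Condition A the upper one; [D <= 1] permits a common constant. *)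
Lemma quotient_quasi_bernoulli (R : realType) (c D x y z X Y Z : R) :
  0 < c -> 0 < D -> D <= 1 -> 0 < x -> 0 < y -> 0 < X -> 0 < Y -> 0 < Z ->
  D * (X * Y) <= Z -> Z <= X * Y -> c * (x * y) <= z -> z <= c^-1 * (x * y) ->
  c * D * (x / X * (y / Y)) <= z / Z <= (c * D)^-1 * (x / X * (y / Y)).
Proof.
move=> c0 D0 D1 x0 y0 X0 Y0 Z0 h1 h2 h3 h4.
have XY : 0 < X * Y by rewrite mulr_gt0.
have xy : 0 < x * y by rewrite mulr_gt0.
have z0 : 0 < z by apply: lt_le_trans h3; rewrite mulr_gt0.
rewrite mulf_div; apply/andP; split.
  rewrite ler_pdivlMr // mulrA mulrAC ler_pdivrMr //.
  rewrite (_ : c * D * (x * y) * Z = (c * (x * y)) * (D * Z)); last by ring.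
  apply: ler_pM => //; rewrite ?(ltW (mulr_gt0 _ _)) //.
  by apply: le_trans h2; rewrite ler_piMl // ltW.
rewrite ler_pdivrMr // mulrA mulrAC ler_pdivlMr // mulrC.
rewrite [leRHS](_ : _ = (c * D)^-1 * (x * y * Z)); last by ring.
rewrite [leRHS]mulrC ler_pdivlMr ?mulr_gt0 //.
rewrite (_ : X * Y * z * (c * D) = (c * z) * (D * (X * Y))); last by ring.
apply: ler_pM => //; rewrite ?(ltW (mulr_gt0 _ _)) //.
by rewrite mulrC -ler_pdivlMr // mulrC.
Qed.

(** * Lifting weights and potentials *)

Section Lift.
Variables (R : realType) (k l : nat) (p : 'I_k.+1 -> 'I_l.+1).
Variables (X : set (sq k)) (Y : set (sq l)).
Hypotheses (hX : shift_closed X) (XY : blockmap p @` X = Y).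

(** The mass of each word of [Y] is spread evenly over its fiber. *)
Definition lift_weight (b : seq 'I_l.+1 -> R) (w : seq 'I_k.+1) : R :=
  if `[< allowable X w >] then b (map p w) / (npre X p (map p w))%:R else 0.

Lemma blockmap_in x : X x -> Y (blockmap p x).
Proof. by move=> Xx; rewrite -XY; exists x. Qed.

Lemma npre_word_gt0 x n : X x -> 0 < (npre X p (word (blockmap p x) n))%:R :> R.
Proof.
by move=> /blockmap_in Yx; rewrite ltr0n (npre_gt0 XY) //; exact: allowable_word.
Qed.

Section Weight.
Variable b : seq 'I_l.+1 -> R.
Hypothesis gb : gibbs_weight Y b.

Lemma lift_weight_fiber y :
  wsum (size y) (fun w => (map p w == y)%:R * lift_weight b w) = b y.
Proof.
have -> : wsum (size y) (fun w => (map p w == y)%:R * lift_weight b w) =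
    (npre X p y)%:R * (b y / (npre X p y)%:R).
  rewrite [X in X * _](npreE R) -wsumZr; apply: eq_wsum => w sw; rewrite /lift_weight.
  case: eqP => [->|_]; last by rewrite andbF !mul0r.
  by rewrite andbT; case: asboolP => _; rewrite ?mul1r ?mulr0 ?mul0r.
have [/(npre_gt0 XY) ay|ay] := pselect (allowable Y y).
  by rewrite mulrC divfK // pnatr_eq0 -lt0n.
by have [_ bN _ _] := gb; rewrite bN // mul0r mulr0.
Qed.

Lemma gibbs_weight_lift : conditionA R X Y p -> gibbs_weight X (lift_weight b).
Proof.
move=> /npre_conditionA[D [/andP[D0 D1] hD]].
have [bpos bN b1 [c [c0 hc]]] := gb.
have npos w : allowable X w -> 0 < (npre X p (map p w))%:R :> R.
  by move=> aw; rewrite ltr0n (npre_gt0 XY) //; exact: (allowable_map XY).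
split.
- move=> w aw; rewrite /lift_weight; case: asboolP => // _.
  by apply: divr_gt0; [apply: bpos; exact: (allowable_map XY) | exact: npos].
- by move=> w aw; rewrite /lift_weight; case: asboolP.
- move=> n; transitivity (wsum n b); last exact: b1.
  rewrite (wsum_fiber p); apply: eq_wsum => y <-.
  exact: lift_weight_fiber.
exists (c * D); split; first by rewrite mulr_gt0.
move=> u v auv.
have au := allowable_catl auv; have av := allowable_catr hX auv.
rewrite /lift_weight !asboolT //.
have nuv := npos _ auv; have nu := npos _ au; have nv := npos _ av.
have ayuv := allowable_map XY auv.
move: nuv ayuv; rewrite map_cat => nuv ayuv.
have h1 := hD _ _ ayuv.
have h2 : (npre X p (map p u ++ map p v))%:R <=
    (npre X p (map p u))%:R * (npre X p (map p v))%:R :> R.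
  by rewrite -natrM ler_nat; exact: (npre_cat R p hX).
have /andP[h3 h4] := hc _ _ ayuv.
have bu := bpos _ (allowable_map XY au); have bv := bpos _ (allowable_map XY av).
by rewrite -mulrA in h1; exact: quotient_quasi_bernoulli.
Qed.

Variable mu : {measure set (sqm k) -> \bar R}.
Hypotheses (hXc : word_closed X) (hYc : word_closed Y) (inv : invariant_prob X mu).

Let foo := invariant_prob_fin inv.
Let m := pushforward_measure mu (@measurable_blockmap k l p).

Lemma invariant_pushforward : invariant_prob Y m.
Proof.
have [m1 m2 m3] := inv.
have mY := measurable_cyl_closed hYc.
split.
- by rewrite /m /= /pushforward preimage_setT.
- apply/eqP; rewrite /m /= /pushforward eq_le -{1}m1 -m2; apply/andP; split.
    apply: le_measure; rewrite ?inE //.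
    by rewrite -[X in measurable X]setTI; exact: measurable_blockmap.
  apply: le_measure; rewrite ?inE //; first exact: measurable_cyl_closed.
    by rewrite -[X in measurable X]setTI; exact: measurable_blockmap.
  by move=> x; exact: blockmap_in.
move=> B mB; rewrite /m /= /pushforward -[RHS]m3 //.
by rewrite -[X in measurable X]setTI; exact: measurable_blockmap.
Qed.

Lemma wt_pushforward y :
  wt m y = wsum (size y) (fun w => (map p w == y)%:R * wt mu w).
Proof.
have my : measurable (blockmap p @^-1` cyl y : set (sqm k)).
  by rewrite -[X in measurable X]setTI; apply: measurable_blockmap => //; exact: measurable_cyl.
rewrite /wt /m /= /pushforward (fine_measure_wsum (size y) foo my).
apply: eq_wsum => w sw; case: eqP => [wy|wy].
  rewrite mul1r; congr (fine (mu _)); apply/seteqP; split=> [x []//|x xw]; split=> //.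
  by rewrite /cyl /= blockmap_word -wy size_map (xw : word x (size w) = w).
rewrite mul0r (_ : _ `&` _ = set0) ?measure0 //; apply/seteqP; split=> x // -[].
rewrite /cyl /= blockmap_word => xy xw; apply: wy; rewrite -[RHS]xy -[in LHS]xw.
by rewrite sw.
Qed.

Lemma wt_pushforward_le (K : R) : (forall w, wt mu w <= K * lift_weight b w) ->
  forall y, wt m y <= K * b y.
Proof.
move=> h y; rewrite wt_pushforward -lift_weight_fiber -wsumZ.
apply: ler_wsum => w _; rewrite mulrCA ler_wpM2l //; exact: h.
Qed.

End Weight.
End Lift.
Section LiftPotential.
Variables (R : realType) (k l : nat) (p : 'I_k.+1 -> 'I_l.+1).
Variables (X : set (sq k)) (Y : set (sq l)) (f : nat -> sq l -> R).
Hypotheses (hX : shift_closed X) (XY : blockmap p @` X = Y).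

Definition lift_potential (n : nat) (x : sq k) : R :=
  f n (blockmap p x) / (tphi X p n (blockmap p x))%:R.

Let npre0 x n : X x -> 0 < (npre X p (word (blockmap p x) n))%:R :> R.
Proof. exact: (npre_word_gt0 R XY). Qed.

Let inY x : X x -> Y (blockmap p x) := @blockmap_in _ _ _ _ _ XY x.

Lemma potential_lift : potential Y f -> potential X lift_potential.
Proof.
move=> pf n n0; have [f0 fc] := pf n n0; split=> [x Xx|x e Xx e0].
  by apply: divr_gt0; [apply/f0/inY | exact: npre0].
have [N hN] := fc _ _ (inY Xx) e0.
(* [N] letters control [f n], and [n] letters make the fiber counts equal. *)
exists (maxn N n) => x' Xx' xx'.
have wE j : (j <= maxn N n)%N -> word (blockmap p x) j = word (blockmap p x') j.
  by move=> jn; rewrite !blockmap_word (eq_word_le jn xx').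
rewrite /lift_potential /tphi -(wE n) ?leq_maxr // -mulrBl normrM.
have N0 := npre0 n Xx; rewrite [X in _ * X]gtr0_norm ?invr_gt0 // ltr_pdivrMr //.
apply: (lt_le_trans (hN _ (inY Xx') (wE _ (leq_maxl _ _)))).
(* Fiber counts are at least 1, so dividing by them cannot enlarge the error. *)
by apply: ler_peMr; [exact: ltW | rewrite ler1n -(ltr0n R)].
Qed.

(** The fiber count depends on the first [n] letters only and cancels in the quotient. *)
Lemma bounded_var_lift : bounded_var Y f -> bounded_var X lift_potential.
Proof.
move=> [B hB]; exists B => n x x' n0 Xx Xx' xx'.
have wE : word (blockmap p x) n = word (blockmap p x') n by rewrite !blockmap_word xx'.
rewrite /lift_potential /tphi -wE -mulf_div divff ?mulr1; last first.
  by rewrite invr_eq0 gt_eqF ?npre0.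
exact: hB (inY Xx) (inY Xx') wE.
Qed.

Lemma almost_additive_lift : potential Y f -> conditionA R X Y p ->
  almost_additive Y f -> almost_additive X lift_potential.
Proof.
move=> pf [D [/andP[D0 D1] hD]] [C [C0 hC]].
have f0 n y : (0 < n)%N -> Y y -> 0 < f n y by move=> /pf[h _]; exact: h.
(* Chosen so that [expR (- (C - ln D)) = expR (- C) * D]. *)
exists (C - ln D); split.
  by have := ln_le0 D1; lra.
move=> n m x n0 m0 Xx.
have Yx := inY Xx; set y := blockmap p x in Yx.
have Xz : X (iter n (@shift k) x) by exact: shift_closed_iter.
have zE : blockmap p (iter n (@shift k) x) = iter n (@shift l) y.
  by apply/funext => i; rewrite iter_shiftE /blockmap iter_shiftE.
have Yz := inY Xz; rewrite zE in Yz.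
have [h3 h4] := hC n m y n0 m0 Yx.
have := hD n m (word y (n + m)) (size_word _ _) (allowable_word _ Yx).
rewrite word_cat take_size_cat ?size_word // drop_size_cat ?size_word // -mulrA => h1.
have h2 := npre_cat R p hX (word y n) (word (iter n (@shift l) y) m).
have eC : 0 < expR (- C) := expR_gt0 _.
rewrite -(ler_nat R) natrM in h2.
have e1 : expR (- C) * (f n y * f m (iter n (@shift l) y)) <= f (n + m)%N y.
  by rewrite mulrA.
have e2 : f (n + m)%N y <= (expR (- C))^-1 * (f n y * f m (iter n (@shift l) y)).
  by rewrite -expRN opprK mulrA.
have N0 : 0 < (npre X p (word y n ++ word (iter n (@shift l) y) m))%:R :> R.
  by rewrite -word_cat; exact: npre0.
have M0 : 0 < (npre X p (word (iter n (@shift l) y) m))%:R :> R.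
  by rewrite -zE; exact: npre0.
have /andP[] := quotient_quasi_bernoulli eC D0 D1 (f0 _ _ n0 Yx) (f0 _ _ m0 Yz)
  (npre0 n Xx) M0 N0 h1 h2 e1 e2.
have c1 : expR (- (C - ln D)) = expR (- C) * D.
  by rewrite opprB addrC expRD lnK ?posrE.
have c2 : expR (C - ln D) = (expR (- C) * D)^-1 by rewrite -c1 -expRN opprK.
by rewrite /lift_potential /tphi zE -/y word_cat c1 c2 !mulrA.
Qed.

End LiftPotential.

Theorem theorem5p2 (R : realType) (k l : nat)
  (X : set (sq k)) (Y : set (sq l)) (p : 'I_k.+1 -> 'I_l.+1)
  (f : nat -> sq l -> R) (nu : {measure set (sqm l) -> \bar R}) :
  sofic X -> sofic Y ->
  blockmap p @` X = Y ->
  specification X ->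
  conditionA R X Y p ->
  potential Y f -> almost_additive Y f -> bounded_var Y f ->
  invariant_prob Y nu -> gibbs Y f nu ->
  let g : nat -> sq k -> R :=
    fun n x => f n (blockmap p x) / (tphi X p n (blockmap p x))%:R in
  [/\ potential X g, almost_additive X g & bounded_var X g] /\
  [/\
      (exists mu : {measure set (sqm k) -> \bar R},
          invariant_prob X mu /\ gibbs X g mu),
      (forall mu1 mu2 : {measure set (sqm k) -> \bar R},
          invariant_prob X mu1 -> gibbs X g mu1 ->
          invariant_prob X mu2 -> gibbs X g mu2 ->
          forall A : set (sqm k), measurable A -> mu1 A = mu2 A),
      (forall mu : {measure set (sqm k) -> \bar R},
          invariant_prob X mu -> gibbs X g mu ->
          forall A : set (sqm l), measurable A ->
            mu (blockmap p @^-1` A) = nu A) &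
      var_pressure X g = var_pressure Y f].
Proof.
move=> sX sY XY spec cA pf aa bv inv gnu g.
have hX := sofic_shift sX; have hXc := sofic_closed sX.
have hY := sofic_shift sY; have hYc := sofic_closed sY.
have gb := gibbs_weight_wt hY hYc pf inv gnu aa.
have ga := gibbs_weight_lift hX XY gb cA.
have pg : potential X g by exact: (potential_lift XY pf).
have [C [C0 hf]] := gibbs_wt_bounds inv gnu.
have hg x n : X x -> (0 < n)%N ->
    C^-1 * (expR (n%:R * pressure Y f) * lift_weight p X (wt nu) (word x n)) <= g n x <=
    C * (expR (n%:R * pressure Y f) * lift_weight p X (wt nu) (word x n)).
  move=> Xx n0; have Yx := blockmap_in XY Xx.
  rewrite /lift_weight asboolT; last exact: allowable_word.
  rewrite -blockmap_word /g /tphi !mulrA.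
  have N0 := npre_word_gt0 R XY n Xx.
  by rewrite !ler_pM2r ?invr_gt0 // -!mulrA; exact: hf.
have PE : pressure X g = pressure Y f by exact: (pressureE ga C0 hg).
(* [gibbs X g] refers to the pressure of [g] itself, hence this restatement of [hg]. *)
have hg' := hg; rewrite -PE in hg'.
have [mu0 [K0 [inv0 K00 h0 h0']]] := gibbs_exists hX hXc spec ga.
have specY := specification_factor XY spec.
split; split.
- exact: pg.
- exact: (almost_additive_lift hX XY pf cA aa).
- exact: (bounded_var_lift XY bv).
- exists mu0; split => //.
  exact: (gibbs_of_weight inv0 ga C0 hg' K00 h0 h0').
- move=> mu1 mu2 inv1 g1 inv2 g2.
  have [K1 [K10 h1 _]] := weight_of_gibbs inv1 ga C0 hXc hg' g1.
  have [K2 [K20 h2 h2']] := weight_of_gibbs inv2 ga C0 hXc hg' g2.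
  have K120 : 0 < K1 + K2 by rewrite addr_gt0.
  apply: (gibbs_unique hX spec ga K120 inv1 inv2) => w.
  + by apply: (le_trans (h1 w)); rewrite ler_wpM2r ?(gibbs_weight_ge0 w ga) // lerDl ltW.
  + by apply: (le_trans (h2' w)); rewrite ler_wpM2r ?wt_ge0 // lerDr ltW.
  + by apply: (le_trans (h2 w)); rewrite ler_wpM2r ?(gibbs_weight_ge0 w ga) // lerDr ltW.
- move=> mu inv1 g1 B mB.
  have [K1 [K10 h1 _]] := weight_of_gibbs inv1 ga C0 hXc hg' g1.
  have invm := invariant_pushforward XY hXc hYc inv1.
  (* The summand 1 serves the comparison of [nu] with its own weight [wt nu]. *)
  have K1p : 0 < K1 + 1 by rewrite addr_gt0.
  apply: (gibbs_unique hY specY gb K1p invm inv _ _ _ mB) => w.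
  + apply: (le_trans (wt_pushforward_le XY gb inv1 h1 w)).
    by rewrite ler_wpM2r ?wt_ge0 // lerDl.
  + by rewrite ler_peMl ?wt_ge0 // lerDr ltW.
  + by rewrite ler_peMl ?wt_ge0 // lerDr ltW.
- rewrite (var_pressureE hX hXc ga pg C0 hg inv0 K00 h0).
  (* On [Y] the supremum is attained by [nu], which equals its own weight, so the constant is 1. *)
  apply/esym; apply: (var_pressureE hY hYc gb pf C0 hf inv ltr01) => w.
  by rewrite mul1r.
Qed.
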